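(* Suppose that for all $\epsilon\in(0,1/2)$, $\delta\in(0,1)$, $c,d\in\mathbb{N}^+$ and all $\gamma>0$, $$G^d_{\mathcal{U}^c\to\mathcal{C}}(\epsilon,\delta,n)\in O(n^{1+\gamma})\quad\text{as } n\to\infty.$$ Then $\mathbf{P}\neq\mathbf{NP}$.
   Context: Let $\mathcal{B}=\{0,1\}$, let $\mathcal{B}^*$ be the set of finite binary strings and $|h|$ the length of $h\in\mathcal{B}^*$. For $n\in\mathbb{N}^+$, $H^n$ is the set of all functions $\mathcal{B}^n\to\mathcal{B}$ and $\Delta(\mathcal{B}^n)$ the set of probability distributions on $\mathcal{B}^n$. A learning problem is a pair $(f,\mathcal{P})$ with $f\in H^n$, $\mathcal{P}\in\Delta(\mathcal{B}^n)$; an $m$-sample dataset for it is the random sequence $[(x_j,f(x_j))]_{j=1}^m$ with $x_1,\dots,x_m$ i.i.d. $\sim\mathcal{P}$. The accuracy of $\hat f\in H^n$ is $\mathrm{acc}^{\mathcal{P}}_f(\hat f)=\Pr_{x\sim\mathcal{P}}[\hat f(x)=f(x)]$. For $\epsilon\in(0,1/2)$, $\delta\in(0,1)$, an algorithm $\mathcal{A}$ has an $(\epsilon,\delta)$-PAC-learning performance with an $m$-sample dataset on $(f,\mathcal{P})$ if for every $m'\ge m$, with probability at least $1-\delta$ over an $m'$-sample dataset $S$, $\mathrm{acc}^{\mathcal{P}}_f(\mathcal{A}(S))\ge 1-\epsilon$. An interpreter is a Turing machine computing a partial function $\varphi:\mathcal{B}^*\times\mathcal{B}^*\to\mathcal{B}\cup\{\bot\}$,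 where $\bot$ denotes non-halting (or invalid) output. For $f\in H^n$, $|f|_\varphi=\min\{|h|:\varphi(h,x)=f(x)\ \forall x\in\mathcal{B}^n\}$ ($+\infty$ if no such $h$). The learning algorithm $\mathit{MDL}^\varphi$, on a dataset $[(x_j,y_j)]_{j=1}^m$ with $x_j\in\mathcal{B}^n$, selects $h^*$ of minimal length among all $h$ with $\varphi(h,x_j)=y_j$ for all $j$ and $\varphi(h,x)\neq\bot$ for all $x\in\mathcal{B}^n$ (ties broken arbitrarily) and outputs $x\mapsto\varphi(h^*,x)$ on $\mathcal{B}^n$. $m^{\epsilon,\delta}_\varphi(f,\mathcal{P})$ is the least $m\in\mathbb{N}^+$ such that $\mathit{MDL}^\varphi$ has an $(\epsilon,\delta)$-PAC-learning performance with an $m$-sample dataset on $(f,\mathcal{P})$ ($+\infty$ if none). For interpreters $\varphi,\psi$ and $n,d\in\mathbb{N}^+$, the sample efficiency gain is $G^d_{\varphi\to\psi}(\epsilon,\delta,n)=\sup\{ m^{\epsilon,\delta}_\psi(f,\mathcal{P})/m^{\epsilon,\delta}_\varphi(f,\mathcal{P}) : f\in H^n,\ \mathcal{P}\in\Delta(\mathcal{B}^n),\ |f|_\varphi\le n^d\}$. Turing machines have alphabet $\{0,1,b\}$ ($b$ blank), a finite state set containing an initial state and two final states accept/reject; the output is $1$ if halting in accept, $0$ if halting in reject, $\bot$ otherwise; multi-tape machines have read-only input tapes and read/write work tapes, and the transition function is a finite list of rules. $E(T)$ is a fixed prefix-free binary encoding of a machine $T$ listing its rules (of length at least 2 for every machine).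 For $c\in\mathbb{N}^+$, $\mathcal{U}^c$ is a time-bounded universal interpreter (a 2-input-tape, 3-work-tape machine): on $(p,x)$ with $n=|x|$, it checks within $n^c$ steps whether $p=E(T)u$ for a two-input-tape machine $T$ and $u\in\mathcal{B}^*$ (outputting $\bot$ if not, or if the check does not finish), then simulates $T$ on $(u,x)$ with an efficient universal simulation (Hennie–Stearns, overhead $O(t\log t)$ for $t$ simulated steps), devoting at most $n^c$ of its own steps to the simulation; it outputs $T$'s output if $T$ halts within this budget and $0$ otherwise. For fixed $p$ it runs in at most $\beta n^c$ steps for a constant $\beta$. In particular, if a Turing machine computes $g:\mathcal{B}^*\to\mathcal{B}$ in time $O(n^{c'})$ with $c'<c$, there is $h\in\mathcal{B}^*$ with $\mathcal{U}^c(h,x)=g(x)$ for all $x$ of sufficiently large length. A Boolean circuit on $n$ inputs is a DAG with a unique sink (output) whose sources are labelled by input indices in $\{1,\dots,n\}$ and whose other vertices (gates) are labelled AND, OR (two incoming edges) or NOT (one incoming edge); its size $|C|$ is its number of vertices. The circuit interpreter $\mathcal{C}$ reads a program $h=0^{\lceil\log_2 n\rceil}1\,[\text{binary expansion of } n]\,0^{|C|}1\,[\text{description of vertex } i]_{i=1}^{|C|}$, each vertex being described by its label and its parents/input index using $\max\{2\lceil\log_2|C|\rceil,\lceil\log_2 n\rceil\}$ bits beyond the label bits, so a circuit $C$ on $n$ inputs has encoding length $L(|C|,n)=2\lceil\log_2 n\rceil+2+|C|(3+\max\{2\lceil\log_2|C|\rceil,\lceil\log_2 n\rceil\})$; $\mathcal{C}(h,x)$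 is the circuit's output on $x\in\mathcal{B}^n$, and $\bot$ if $h$ is malformed. Hence $|f|_{\mathcal{C}}=\min\{L(|C|,n): C \text{ computes } f\}$. $\mathbf{P}$ and $\mathbf{NP}$ are the usual complexity classes. *)

(* Defs.v *)
From mathcomp Require Import all_boot all_order all_algebra.
From mathcomp Require Import boolp classical_sets reals ereal exp.
Set Implicit Arguments. Unset Strict Implicit. Unset Printing Implicit Defensive.
Import Order.TTheory GRing.Theory Num.Theory.
Local Open Scope ring_scope.

(* Turing machines: alphabet {0,1,b} = option bool (None = blank),     *)
(* finite state set 'I_Q with initial / accept / reject states,        *)
(* ni read-only input tapes and k read/write work tapes.                *)
Inductive move := MLeft | MStay | MRight.

Record TM := MkTM {
  tm_Q : nat; tm_ni : nat; tm_k : nat;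
  tm_start : 'I_tm_Q; tm_acc : 'I_tm_Q; tm_rej : 'I_tm_Q;
  tm_delta : 'I_tm_Q -> {ffun 'I_tm_ni -> option bool} -> {ffun 'I_tm_k -> option bool} ->
             'I_tm_Q * {ffun 'I_tm_k -> option bool} * {ffun 'I_tm_ni -> move} * {ffun 'I_tm_k -> move} }.

Record config (M : TM) := Cfg {
  cf_q : 'I_(tm_Q M);
  cf_ih : 'I_(tm_ni M) -> nat;
  cf_wt : 'I_(tm_k M) -> nat -> option bool;
  cf_wh : 'I_(tm_k M) -> nat }.

Definition mv (m : move) (p : nat) : nat :=
  match m with MLeft => p.-1 | MStay => p | MRight => p.+1 end.

Definition final (M : TM) (q : 'I_(tm_Q M)) : bool := (q == tm_acc M) || (q == tm_rej M).

(* input tape i holds the word inp i followed by blanks *)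
Definition init (M : TM) (inp : nat -> seq bool) : config M :=
  @Cfg M (tm_start M) (fun _ => 0%N) (fun _ _ => None) (fun _ => 0%N).

Definition step (M : TM) (inp : nat -> seq bool) (c : config M) : config M :=
  if final (cf_q c) then c else
  let rin := [ffun i : 'I_(tm_ni M) => nth None (map Some (inp (val i))) (cf_ih c i)] in
  let rwk := [ffun j : 'I_(tm_k M) => cf_wt c j (cf_wh c j)] in
  match tm_delta (cf_q c) rin rwk with
  | (q', w, mi, mw) =>
    @Cfg M q' (fun i => mv (mi i) (cf_ih c i))
      (fun j p => if p == cf_wh c j then w j else cf_wt c j p)
      (fun j => mv (mw j) (cf_wh c j))
  end.

Definition tm_out (M : TM) (inp : nat -> seq bool) (t : nat) : option bool :=
  let c := iter t (step inp) (init M inp) in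
  if cf_q c == tm_acc M then Some true
  else if cf_q c == tm_rej M then Some false else None.

Definition inp1 (x : seq bool) : nat -> seq bool := fun _ => x.
Definition inp2 (x w : seq bool) : nat -> seq bool := fun i => if i == 0%N then x else w.

Definition inP (L : seq bool -> Prop) : Prop :=
  exists (M : TM) (k : nat), tm_ni M = 1%N /\
    forall x, exists b, tm_out M (inp1 x) (k * size x ^ k + k) = Some b /\ (b = true <-> L x).

Definition inNP (L : seq bool -> Prop) : Prop :=
  exists (M : TM) (k : nat), tm_ni M = 2%N /\
    forall x, (L x <-> exists w, (size w <= k * size x ^ k + k)%N /\
                        tm_out M (inp2 x w) (k * size x ^ k + k) = Some true).

Definition P_neq_NP : Prop := exists L, inNP L /\ ~ inP L.

(* Interpreters.  A general "description system": programs with a      *)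
(* length, evaluated on binary inputs, None = bottom.                   *)
Record interp := MkInterp {
  prog : Type; plen : prog -> nat; run : prog -> seq bool -> option bool }.

Definition str_interp (phi : seq bool -> seq bool -> option bool) : interp :=
  @MkInterp (seq bool) size phi.

(* Universality property of the time-bounded universal interpreters U^c:
   if a (one-input-tape) TM computes g in time O(n^c') with c' < c, then
   some program h satisfies U^c(h,x) = g(x) for all x of large length. *)
Definition universal_family (U : nat -> seq bool -> seq bool -> option bool) : Prop :=
  forall (c c' : nat) (M : TM) (g : seq bool -> bool) (K : nat),
    (c' < c)%N -> tm_ni M = 1%N ->
    (forall x, tm_out M (inp1 x) (K * size x ^ c' + K) = Some (g x)) ->
    exists h : seq bool, exists N : nat, forall x, (N <= size x)%N -> U c h x = Some (g x).

(* Vertices are listed in a topological order; parents are referred    *)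
(* to by (0-based) position; input indices are 0-based (< n).           *)
Inductive vertex := VIn of nat | VAnd of nat & nat | VOr of nat & nat | VNot of nat.

Record circuit := Circuit { c_n : nat; c_vs : seq vertex }.

Definition parents (v : vertex) : seq nat :=
  match v with VIn _ => [::] | VAnd a b => [:: a; b] | VOr a b => [:: a; b] | VNot a => [:: a] end.

Definition vertex_ok (n i : nat) (v : vertex) : bool :=
  match v with
  | VIn k => (k < n)%N
  | VAnd a b | VOr a b => [&& (a < i)%N, (b < i)%N & a != b]
  | VNot a => (a < i)%N
  end.

(* well-formed DAG with a unique sink (the last vertex) *)
Definition circuit_wf (C : circuit) : bool :=
  let vs := c_vs C in
  [&& (0 < size vs)%N,
      all (fun i => vertex_ok (c_n C) i (nth (VIn 0) vs i)) (iota 0 (size vs)) &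
      all (fun i => has (fun v => i \in parents v) vs) (iota 0 (size vs).-1)].

Definition eval_vertex (x : seq bool) (vals : seq bool) (v : vertex) : bool :=
  match v with
  | VIn k => nth false x k
  | VAnd a b => nth false vals a && nth false vals b
  | VOr a b => nth false vals a || nth false vals b
  | VNot a => ~~ nth false vals a
  end.

Definition circuit_vals (C : circuit) (x : seq bool) : seq bool :=
  foldl (fun vals v => rcons vals (eval_vertex x vals v)) [::] (c_vs C).

Definition circuit_eval (C : circuit) (x : seq bool) : option bool :=
  if circuit_wf C && (size x == c_n C) then Some (last false (circuit_vals C x)) else None.

Definition clog2 (n : nat) : nat := up_log 2 n.  (* = ceil(log2 n) for n >= 1 *)

(* L(|C|,n): length of the binary encoding of a circuit of size s on n inputs *)
Definition Lenc (s n : nat) : nat :=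
  (2 * clog2 n + 2 + s * (3 + maxn (2 * clog2 s) (clog2 n)))%N.

Definition Cinterp : interp :=
  @MkInterp circuit (fun C => Lenc (size (c_vs C)) (c_n C)) circuit_eval.

Section Learning.
Variable R : realType.

Definition is_dist n (P : {ffun n.-tuple bool -> R}) : Prop :=
  (forall x, 0 <= P x) /\ \sum_x P x = 1.

Definition acc n (P : {ffun n.-tuple bool -> R}) (f g : n.-tuple bool -> bool) : R :=
  \sum_(x | g x == f x) P x.

Definition prob_data n m (P : {ffun n.-tuple bool -> R})
    (E : {ffun 'I_m -> n.-tuple bool} -> Prop) : R :=
  \sum_(xs : {ffun 'I_m -> n.-tuple bool}) (\prod_j P (xs j)) * (if `[< E xs >] then 1 else 0).

Definition computes (phi : interp) n (h : prog phi) (f : n.-tuple bool -> bool) : Prop :=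
  forall x : n.-tuple bool, run h x = Some (f x).

Definition desc_len_le (phi : interp) n (f : n.-tuple bool -> bool) (k : nat) : Prop :=
  exists h : prog phi, computes h f /\ (plen h <= k)%N.

Definition consistent (phi : interp) n m (xs : {ffun 'I_m -> n.-tuple bool})
    (f : n.-tuple bool -> bool) (h : prog phi) : Prop :=
  (forall x : n.-tuple bool, run h x <> None) /\
  (forall j, run h (xs j) = Some (f (xs j))).

Definition mdl_choice (phi : interp) n m xs f (h : prog phi) : Prop :=
  @consistent phi n m xs f h /\ forall h', @consistent phi n m xs f h' -> (plen h <= plen h')%N.

Definition out_fun (phi : interp) n (h : prog phi) : n.-tuple bool -> bool :=
  fun x => odflt false (run h x).

(* MDL^phi (with any tie-breaking rule A) has (eps,delta)-PAC performance
   with an m-sample dataset on (f,P) *)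
Definition mdl_pac (phi : interp) n (f : n.-tuple bool -> bool) (P : {ffun n.-tuple bool -> R})
    (eps del : R) (m : nat) : Prop :=
  forall m', (m <= m')%N ->
  forall A : {ffun 'I_m' -> n.-tuple bool} -> prog phi,
    (forall xs, (exists h : prog phi, mdl_choice xs f h) -> mdl_choice xs f (A xs)) ->
    1 - del <= prob_data P (fun xs => (exists h : prog phi, mdl_choice xs f h) /\
                                      1 - eps <= acc P f (out_fun (A xs))).

(* m^{eps,delta}_phi(f,P): Some m (least m >= 1) or None (= +infinity) *)
Definition sample_cplx (phi : interp) n f (P : {ffun n.-tuple bool -> R}) (eps del : R)
    : option nat :=
  let Pm : pred nat := fun m => `[< (0 < m)%N /\ @mdl_pac phi n f P eps del m >] in
  match pselect (exists m, Pm m) with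
  | left H => Some (ex_minn H)
  | right _ => None
  end.

Definition ratio (a b : option nat) : \bar R :=
  match a, b with
  | Some a, Some b => (a%:R / b%:R)%:E
  | None, _ => +oo%E
  | Some _, None => 0%E
  end.

Definition gain (phi psi : interp) (d : nat) (eps del : R) (n : nat) : \bar R :=
  ereal_sup [set r | exists (f : n.-tuple bool -> bool) (P : {ffun n.-tuple bool -> R}),
      is_dist P /\ desc_len_le phi f (n ^ d) /\
      r = ratio (sample_cplx psi f P eps del) (sample_cplx phi f P eps del)].

Definition bigO_pow (G : nat -> \bar R) (a : R) : Prop :=
  exists (K : R) (N : nat), forall n, (N <= n)%N -> (G n <= (K * (n%:R `^ a))%:E)%E.

End Learning.

(* Main.v *)
Require Import Defs.
From mathcomp Require Import all_boot all_order all_algebra.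
From mathcomp Require Import boolp classical_sets reals ereal exp.
From mathcomp Require Import zify lra.
Set Implicit Arguments. Unset Strict Implicit. Unset Printing Implicit Defensive.

(* Suppose P = NP, and let a table of N = 2^r bits be easy if some token program of about N/8 bits
   (a straight-line program for a one-head evaluator) agrees with it on three quarters of its
   entries. Easiness is in NP, hence in P, and then so is being the lexicographically first hard
   table of length N; a counting argument shows that hard tables exist. The language L of the
   strings that index a 1 in the first hard table of the appropriate length is therefore in NP,
   hence in P, and U^c has a program of constant length for it, so that MDL^U learns L from O(1)
   samples. On the uniform distribution over the 2^r >= n^25 inputs that index the table, n^3
   samples can be memorised by a circuit of description length at most n^11, and circuits of that
   length translate to token programs too short to reach accuracy 3/4. Hence MDL^C needs more than
   n^3 samples, which contradicts a gain of O(n^2). *)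

(** * Turing machines from structured programs *)

(** A circuit that memorises the sample has to be shown inaccurate, not just wrong somewhere, so
    easiness is agreement on three quarters of the table: hardness is needed on average. Easiness
    must moreover be verified by an explicit Turing machine. Evaluating circuits directly would
    require parsing and random access; token programs avoid both, as every string is one and each
    token acts at a single head in a constant number of steps. The price is a quadratic blow-up in
    the translation of circuits, which only raises the exponent of n in the length of the table.
    Passing from NP to P is what provides negative answers: a hard table is certified by the answer
    no of a machine for [easy], and the first one by the answer no of a machine for [not_first].
    This needs machines that run a program and then call a given machine, hence the small
    programming language below, in which running times add up. *)

Definition symbol (s : seq bool) (p : nat) : option bool := nth None (map Some s) p.

(** P carries no data: only [lP] is visible, so the position of its head serves as a unary counter.
    The flags for the left ends are there because a left move at cell 0 has no effect that a machine
    could observe. *)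
Record reading := Reading {
  rX : option bool; rY : option bool; rA : bool; rC : bool; rD : bool;
  rB : option bool; rV : option bool; lX : bool; lY : bool; lB : bool; lP : bool }.

Record action := Action {
  mX : move; mY : move; mB : move; mP : move;
  wA : option bool; wC : option bool; wD : option bool; wB : option bool; wV : option bool }.

Record store := Store {
  hX : nat; hY : nat; hB : nat; hP : nat; vA : bool; vC : bool; vD : bool;
  tB : nat -> option bool; tV : nat -> option bool }.

Definition store0 : store :=
  Store 0 0 0 0 false false false (fun _ => None) (fun _ => None).

(** [None] stands for no write; a program never writes a blank. *)
Definition put (f : nat -> option bool) (h : nat) (w : option bool) : nat -> option bool :=
  if w is Some b then fun p => if p == h then Some b else f p else f.

Arguments put : simpl never.

Definition perform (a : action) (s : store) : store :=
  Store (mv (mX a) (hX s)) (mv (mY a) (hY s)) (mv (mB a) (hB s)) (mv (mP a) (hP s))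
    (odflt (vA s) (wA a)) (odflt (vC s) (wC a)) (odflt (vD s) (wD a))
    (put (tB s) (hB s) (wB a)) (put (tV s) (hB s) (wV a)).

(* [inl b] is an exit with flag [b]; [inr h] halts the whole computation with answer [h]. *)
Definition outcome := (bool + bool)%type.

Record program := MkProgram {
  pQ : finType; pstart : pQ; pdelta : pQ -> reading -> (pQ + outcome) * action }.

Definition basic (f : reading -> outcome * action) : program :=
  @MkProgram unit tt (fun _ r => let: (o, a) := f r in (inr o, a)).

Definition ite (m m1 m2 : program) : program :=
  @MkProgram (pQ m + (pQ m1 + pQ m2))%type (inl (pstart m))
    (fun q r => match q with
     | inl q => let: (o, a) := pdelta q r in
         (match o with
          | inl q' => inl (inl q')
          | inr (inl true) => inl (inr (inl (pstart m1)))
          | inr (inl false) => inl (inr (inr (pstart m2)))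
          | inr (inr h) => inr (inr h) end, a)
     | inr (inl q) => let: (o, a) := pdelta q r in
         (match o with inl q' => inl (inr (inl q')) | inr o => inr o end, a)
     | inr (inr q) => let: (o, a) := pdelta q r in
         (match o with inl q' => inl (inr (inr q')) | inr o => inr o end, a)
     end).

Definition loop (m : program) : program :=
  @MkProgram (pQ m) (pstart m)
    (fun q r => let: (o, a) := pdelta q r in
       (match o with
        | inl q' => inl q'
        | inr (inl true) => inl (pstart m)
        | inr o => inr o end, a)).

Definition pseq (m m' : program) : program := ite m m' m'.

Section Exec.
Variables X Y : seq bool.

Definition look (s : store) : reading :=
  Reading (symbol X (hX s)) (symbol Y (hY s)) (vA s) (vC s) (vD s)
    (tB s (hB s)) (tV s (hB s)) (hX s == 0) (hY s == 0) (hB s == 0) (hP s == 0).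

Inductive exec (m : program) : pQ m -> store -> outcome -> store -> nat -> Prop :=
| exec1 q s o a : pdelta q (look s) = (inr o, a) -> exec q s o (perform a s) 1
| execS q q' s a o s' t : pdelta q (look s) = (inl q', a) ->
    exec q' (perform a s) o s' t -> exec q s o s' t.+1.

Definition runs (m : program) s o s' b := exists2 t, t <= b & exec (pstart m) s o s' t.

Lemma runs_weaken m s o s' b b' : runs m s o s' b -> b <= b' -> runs m s o s' b'.
Proof. by move=> [t tb e] bb; exists t => //; apply: leq_trans bb. Qed.

Lemma runs_basic f s o a : f (look s) = (o, a) -> runs (basic f) s o (perform a s) 1.
Proof. by move=> e; exists 1 => //; apply: exec1; rewrite /= e. Qed.

Lemma exec_ite1 m m1 m2 (q : pQ m1) s o s' t :
  exec q s o s' t -> @exec (ite m m1 m2) (inr (inl q)) s o s' t.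
Proof.
elim=> {q s o s' t} [q s o a e|q q' s a o s' t e _ IH].
  by apply: exec1; rewrite /= e.
by apply: (execS (a := a) _ IH); rewrite /= e.
Qed.

Lemma exec_ite2 m m1 m2 (q : pQ m2) s o s' t :
  exec q s o s' t -> @exec (ite m m1 m2) (inr (inr q)) s o s' t.
Proof.
elim=> {q s o s' t} [q s o a e|q q' s a o s' t e _ IH].
  by apply: exec1; rewrite /= e.
by apply: (execS (a := a) _ IH); rewrite /= e.
Qed.

Lemma runs_ite m m1 m2 s (b : bool) s1 b1 o s2 b2 :
  runs m s (inl b) s1 b1 -> runs (if b then m1 else m2) s1 o s2 b2 ->
  runs (ite m m1 m2) s o s2 (b1 + b2).
Proof.
move=> [t1 l1 e1] [t2 l2 e2]; exists (t1 + t2); first exact: leq_add.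
rewrite /=; move: (pstart m) e1 => q e1; move El: (inl b) e1 => o1 e1.
elim: e1 El e2 => {l1 s s1 o1 t1 q} [q s o1 a e|q q' s a o1 s' t e _ IH] El e2.
  subst o1; case: b e e2 => e e2.
    by apply: (execS (a := a) _ (exec_ite1 m m2 e2)); rewrite /= e.
  by apply: (execS (a := a) _ (exec_ite2 m m1 e2)); rewrite /= e.
by apply: (execS (a := a) _ (IH El e2)); rewrite /= e.
Qed.

Lemma runs_ite_halt m m1 m2 s h s1 b1 :
  runs m s (inr h) s1 b1 -> runs (ite m m1 m2) s (inr h) s1 b1.
Proof.
move=> [t1 l1 e1]; exists t1 => //=.
move: (pstart m) e1 => q e1; move El: (inr h) e1 => o1 e1.
elim: e1 El => {l1 s s1 o1 t1 q} [q s o1 a e|q q' s a o1 s' t e _ IH] El.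
  by subst o1; apply: exec1; rewrite /= e.
by apply: (execS (a := a) _ (IH El)); rewrite /= e.
Qed.

Lemma runs_seq m m' s b s1 b1 o s2 b2 :
  runs m s (inl b) s1 b1 -> runs m' s1 o s2 b2 -> runs (pseq m m') s o s2 (b1 + b2).
Proof. by move=> r1 r2; apply: runs_ite r1 _; case: b. Qed.

Lemma runs_loop m s s1 b1 o s2 b2 :
  runs m s (inl true) s1 b1 -> runs (loop m) s1 o s2 b2 -> runs (loop m) s o s2 (b1 + b2).
Proof.
move=> [t1 l1 e1] [t2 l2 e2]; exists (t1 + t2); first exact: leq_add.
rewrite /=; move: (pstart m) e1 => q e1; move El: (inl true) e1 => o1 e1.
elim: e1 El e2 => {l1 s s1 o1 t1 q} [q s o1 a e|q q' s a o1 s' t e _ IH] El e2.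
  by subst o1; apply: (execS (a := a) _ e2); rewrite /= e.
by apply: (execS (a := a) _ (IH El e2)); rewrite /= e.
Qed.

Lemma runs_loop_end m s o s1 b1 :
  o != inl true -> runs m s o s1 b1 -> runs (loop m) s o s1 b1.
Proof.
move=> oN [t1 l1 e1]; exists t1 => //.
rewrite /=; move: (pstart m) e1 => q e1.
elim: e1 oN => {l1 s s1 o t1 q} [q s o1 a e|q q' s a o1 s' t e _ IH] oN.
  by apply: exec1; rewrite /= e; case: o1 oN {e} => [[]|].
by apply: (execS (a := a) _ (IH oN)); rewrite /= e.
Qed.

(** [F i] is the store after i rounds. Giving this sequence in closed form is how the loops below
    are verified. The induction goes backwards from the last round. *)
Lemma runs_loop_iter (F : nat -> store) m n o s' b :
  (forall i, i < n -> runs m (F i) (inl true) (F i.+1) b) ->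
  o != inl true -> runs m (F n) o s' b -> runs (loop m) (F 0) o s' (n.+1 * b).
Proof.
move=> step oN last.
suff H k : k <= n -> runs (loop m) (F (n - k)) o s' (k.+1 * b).
  by have := H n (leqnn n); rewrite subnn.
elim: k => [|k IH] lek; first by rewrite subn0 mul1n; exact: runs_loop_end.
rewrite mulSn; apply: runs_loop (IH (ltnW lek)).
have -> : n - k = (n - k.+1).+1 by lia.
by apply: step; lia.
Qed.

End Exec.

(* Nine work tapes: three one-cell registers, the tapes B and V with a common head, and tapes
   marked at cell 0 only, that let the heads of B, P, X and Y recognise their left end. *)
Definition dev_head (s : store) (n : nat) : nat :=
  match n with 0 | 1 | 2 => 0 | 3 | 4 | 5 => hB s | 6 => hP s | 7 => hX s | _ => hY s end.

Definition dev_cell (s : store) (n p : nat) : option bool :=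
  match n with
  | 0 => if p == 0 then Some (vA s) else None
  | 1 => if p == 0 then Some (vC s) else None
  | 2 => if p == 0 then Some (vD s) else None
  | 3 => tB s p
  | 4 => tV s p
  | _ => if p == 0 then Some true else None
  end.

Definition dev_move (a : action) (n : nat) : move :=
  match n with 0 | 1 | 2 => MStay | 3 | 4 | 5 => mB a | 6 => mP a | 7 => mX a | _ => mY a end.

Definition dev_write (r : nat -> option bool) (a : action) (n : nat) : option bool :=
  let w := match n with 0 => wA a | 1 => wC a | 2 => wD a | 3 => wB a | 4 => wV a | _ => None end in
  if w is Some b then Some b else r n.

Definition dev_mark (n : nat) : option bool :=
  match n with 0 | 1 | 2 => Some false | 3 | 4 => None | _ => Some true end.

Lemma tm_out_mono M inp t t' b : tm_out M inp t = Some b -> t <= t' -> tm_out M inp t' = Some b.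
Proof.
rewrite /tm_out => e /subnK <-; rewrite iterD.
set c := iter t _ _ in e *.
have fc : final (cf_q c).
  by rewrite /final; move: e; case: eqP => //; case: eqP.
suff -> : iter (t' - t) (step inp) c = c by [].
by elim: (t' - t) => //= k ->; rewrite /step fc.
Qed.

Lemma tm_out_inj M inp t t' b b' : tm_out M inp t = Some b -> tm_out M inp t' = Some b' -> b = b'.
Proof.
move=> e e'; have e1 := tm_out_mono e (leq_addr t' t).
by have := tm_out_mono e' (leq_addl t t'); rewrite e1 => -[].
Qed.

(** * From a program to a machine that ends by calling another machine *)

Section Build.
Variable p : program.
Variables (QM kM : nat) (sM aM rM : 'I_QM).
Variable dM : 'I_QM -> {ffun 'I_1 -> option bool} -> {ffun 'I_kM -> option bool} ->
             'I_QM * {ffun 'I_kM -> option bool} * {ffun 'I_1 -> move} * {ffun 'I_kM -> move}.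

Let M := @MkTM QM 1 kM sM aM rM dM.

(** [None] is the initial state, in which the marks are written. The rest are the states of p, the
    states of M paired with the flag on which p exited, and the two verdicts. *)
Definition bstate : finType := option ((pQ p + bool * 'I_QM) + bool)%type.

Implicit Types (rin : {ffun 'I_2 -> option bool}) (rwk : {ffun 'I_(9 + kM) -> option bool}).

Definition dev_sym rwk (n : nat) : option bool :=
  if insub n is Some i then rwk (lshift kM (i : 'I_9)) else None.

Definition breading rin rwk : reading :=
  let r := dev_sym rwk in
  Reading (rin ord0) (rin ord_max) (r 0 == Some true) (r 1 == Some true) (r 2 == Some true)
    (r 3) (r 4) (r 7 == Some true) (r 8 == Some true) (r 5 == Some true) (r 6 == Some true).

Definition on_tapes T (f : nat -> T) (g : 'I_kM -> T) : {ffun 'I_(9 + kM) -> T} :=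
  [ffun j => match split j with inl i => f (val i) | inr j => g j end].

Definition on_inputs (m0 m1 : move) : {ffun 'I_2 -> move} :=
  [ffun i : 'I_2 => if val i == 0 then m0 else m1].

Definition bdelta (q : 'I_#|bstate|) rin rwk :
    'I_#|bstate| * {ffun 'I_(9 + kM) -> option bool} * {ffun 'I_2 -> move} * {ffun 'I_(9 + kM) ->
      move} :=
  let keepM := fun j => rwk (rshift 9 j) in
  match enum_val q with
  | None => (enum_rank (Some (inl (inl (pstart p))) : bstate),
             on_tapes dev_mark keepM, on_inputs MStay MStay, on_tapes (fun _ => MStay)
               (fun _ => MStay))
  | Some (inl (inl q)) =>
      let: (o, a) := pdelta q (breading rin rwk) in
      (enum_rank (match o with
         | inl q' => Some (inl (inl q'))
         | inr (inl b) => Some (inl (inr (b, sM)))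
         | inr (inr h) => Some (inr h) end : bstate),
       on_tapes (dev_write (dev_sym rwk) a) keepM, on_inputs (mX a) (mY a),
       on_tapes (dev_move a) (fun _ => MStay))
  | Some (inl (inr (b, q))) =>
      if @final M q then
        (enum_rank (Some (inr (b == (q == aM))) : bstate),
         on_tapes (dev_sym rwk) keepM, on_inputs MStay MStay, on_tapes (fun _ => MStay)
           (fun _ => MStay))
      else
        let: (q', w, mi, mw) := dM q [ffun => rin ord_max] [ffun j => keepM j] in
        (enum_rank (Some (inl (inr (b, q'))) : bstate),
         on_tapes (dev_sym rwk) w, on_inputs MStay (mi ord0), on_tapes (fun _ => MStay) mw)
  | Some (inr h) =>
      (q, on_tapes (dev_sym rwk) keepM, on_inputs MStay MStay, on_tapes (fun _ => MStay)
        (fun _ => MStay))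
  end.

(* Runs the program [p]; on exit with flag [b] runs M on the second input and accepts iff M
   answers [b]. *)
Definition build : TM :=
  @MkTM #|bstate| 2 (9 + kM) (enum_rank (None : bstate)) (enum_rank (Some (inr true) : bstate))
    (enum_rank (Some (inr false) : bstate)) bdelta.

Variables X Y : seq bool.

Notation inp := (inp2 X Y).

Definition dev_rep (s : store) (c : config build) : Prop :=
  [/\ cf_ih c ord0 = hX s, cf_ih c ord_max = hY s,
      forall i : 'I_9, cf_wh c (lshift kM i) = dev_head s i &
      forall (i : 'I_9) x, cf_wt c (lshift kM i) x = dev_cell s i x].

(** Preserved while p runs, so that M later starts on blank work tapes. *)
Definition blank_rep (c : config build) : Prop :=
  forall j : 'I_kM, cf_wh c (rshift 9 j) = 0 /\ forall x, cf_wt c (rshift 9 j) x = None.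

Definition M_rep (cM : config M) (c : config build) : Prop :=
  cf_ih c ord_max = cf_ih cM ord0 /\
  forall j : 'I_kM, cf_wh c (rshift 9 j) = cf_wh cM j /\
    forall x, cf_wt c (rshift 9 j) x = cf_wt cM j x.

Lemma on_tapesl T f g i : @on_tapes T f g (lshift kM i) = f (val i).
Proof. by rewrite ffunE (unsplitK (inl i : 'I_9 + 'I_kM)). Qed.

Lemma on_tapesr T f g i : @on_tapes T f g (rshift 9 i) = g i.
Proof. by rewrite ffunE (unsplitK (inr i : 'I_9 + 'I_kM)). Qed.

Lemma final_build (q : bstate) :
  @final build (enum_rank q) = if q is Some (inr _) then true else false.
Proof.
rewrite /final /= !(inj_eq enum_rank_inj).
by case: q => [[[|]|[]]|].
Qed.

Lemma dev_symE rwk (i : 'I_9) : dev_sym rwk i = rwk (lshift kM i).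
Proof. by rewrite /dev_sym valK. Qed.

Lemma delta_build : @tm_delta build = bdelta.
Proof. by []. Qed.

Lemma cell_at0 (h : nat) : ((if h == 0 then Some true else None) == Some true) = (h == 0).
Proof. by case: (h == 0). Qed.

Lemma breadingE s c :
  dev_rep s c ->
  breading [ffun i : 'I_2 => nth None (map Some (inp (val i))) (cf_ih c i)]
     [ffun j : 'I_(9 + kM) => cf_wt c j (cf_wh c j)] = look X Y s.
Proof.
move=> [hx hy hw ht].
have D n : n < 9 -> dev_sym [ffun j : 'I_(9 + kM) => cf_wt c j (cf_wh c j)] n
     = dev_cell s n (dev_head s n).
  by move=> n9; rewrite /dev_sym insubT ffunE hw ht.
by rewrite /breading !D //= !ffunE hx hy /= !cell_at0 /look; congr Reading;
   case: (vA s); case: (vC s); case: (vD s).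
Qed.

Lemma dev_step s c (q : pQ p) o a :
  dev_rep s c -> blank_rep c -> cf_q c = enum_rank (Some (inl (inl q)) : bstate) ->
  pdelta q (look X Y s) = (o, a) ->
  let c' := step inp c in
  [/\ dev_rep (perform a s) c', blank_rep c' &
    cf_q c' = enum_rank (match o with
         | inl q' => Some (inl (inl q'))
         | inr (inl b) => Some (inl (inr (b, sM)))
         | inr (inr h) => Some (inr h) end : bstate)].
Proof.
move=> rep brep eq ed; rewrite /step eq final_build.
rewrite delta_build /bdelta enum_rankK (breadingE rep) ed /=.
have [hx hy hw ht] := rep.
split=> //.
- split=> /=; rewrite ?ffunE /= ?hx ?hy //.
  + move=> i; rewrite on_tapesl hw; by case: i => [[|[|[|[|[|[|[|[|[|//]]]]]]]]] Hi] /=.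
  + move=> i x; rewrite on_tapesl !hw /dev_write dev_symE ffunE hw !ht.
    case: i => [[|[|[|[|[|[|[|[|[|//]]]]]]]]] Hi] /=.
    * by case: (x =P 0) => [_|//]; case: (wA a).
    * by case: (x =P 0) => [_|//]; case: (wC a).
    * by case: (x =P 0) => [_|//]; case: (wD a).
    * by rewrite /put; case: (wB a) => [b|]; case: (x =P hB s) => // ->.
    * by rewrite /put; case: (wV a) => [b|]; case: (x =P hB s) => // ->.
    * by case: (x =P hB s) => // ->.
    * by case: (x =P hP s) => // ->.
    * by case: (x =P hX s) => // ->.
    * by case: (x =P hY s) => // ->.
- move=> j /=; rewrite !on_tapesr /= ffunE; have [-> hb] := brep j.
  by split=> // x; rewrite !hb; case: ifP.
Qed.

Lemma dev_exec (q : pQ p) s o s' t c :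
  exec X Y q s o s' t -> dev_rep s c -> blank_rep c ->
  cf_q c = enum_rank (Some (inl (inl q)) : bstate) ->
  let c' := iter t (step inp) c in
  [/\ dev_rep s' c', blank_rep c' &
    cf_q c' = enum_rank (match o with
         | inl b => Some (inl (inr (b, sM)))
         | inr h => Some (inr h) end : bstate)].
Proof.
move=> e; elim: e c => {q s o s' t} [q s o a e|q q' s a o s' t e _ IH] c rep brep eq.
  exact: (dev_step rep brep eq e).
rewrite iterSr; have [rep' brep' eq'] := dev_step rep brep eq e.
exact: IH.
Qed.

Lemma dev_init :
  let c := step inp (init build inp) in
  [/\ dev_rep store0 c, blank_rep c & cf_q c = enum_rank (Some (inl (inl (pstart p))) : bstate)].
Proof.
rewrite /step [cf_q _]/= final_build delta_build /bdelta enum_rankK /=.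
split=> //.
- split=> /=; rewrite ?ffunE //.
  + by move=> i; rewrite on_tapesl; case: i => [[|[|[|[|[|[|[|[|[|//]]]]]]]]] Hi] /=.
  + by move=> i x; rewrite on_tapesl; case: i => [[|[|[|[|[|[|[|[|[|//]]]]]]]]] Hi] /=; case: ifP.
- by move=> j /=; rewrite !on_tapesr ffunE; split=> // x; case: ifP.
Qed.

Lemma tm_out_final t h c : iter t (step inp) (init build inp) = c ->
  cf_q c = enum_rank (Some (inr h) : bstate) -> tm_out build inp t = Some h.
Proof.
move=> <- e; rewrite /tm_out e /= !(inj_eq enum_rank_inj).
by case: h {e}.
Qed.

Lemma build_halt h s' b :
  runs X Y p store0 (inr h) s' b -> tm_out build inp b.+1 = Some h.
Proof.
move=> [t tb e]; apply: (@tm_out_mono _ _ t.+1) => //.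
have [rep brep eq] := dev_init.
have [_ _ eq'] := dev_exec e rep brep eq.
by apply: (tm_out_final _ eq'); rewrite iterSr.
Qed.

Lemma M_step c cM b :
  M_rep cM c -> cf_q c = enum_rank (Some (inl (inr (b, cf_q cM))) : bstate) ->
  ~~ final (cf_q cM) ->
  let c' := step inp c in let cM' := step (inp1 Y) cM in
  M_rep cM' c' /\ cf_q c' = enum_rank (Some (inl (inr (b, cf_q cM'))) : bstate).
Proof.
move=> [hy hM] eq nf; rewrite /step eq final_build (negbTE nf).
rewrite delta_build /bdelta enum_rankK (negbTE nf).
set F := dM _ _ _; set G := tm_delta _ _ _.
have FG : F = G.
  rewrite /F /G /=; congr dM; apply/ffunP=> j; rewrite !ffunE /=.
    by rewrite (ord1 j) hy.
  by have [-> ->] := hM j.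
rewrite -FG; case: F {FG G} => [[[q' w] mi] mw] /=; split=> //; split=> /=.
  by rewrite ffunE hy.
move=> j; rewrite !on_tapesr /=; have [-> hb] := hM j.
by split=> // x; rewrite hb.
Qed.

(** [t'] may be smaller than t: M stands still once it is final, whereas the built machine would go
    on to its verdict, so the simulation is stopped there. *)
Lemma M_iter t c cM b :
  M_rep cM c -> cf_q c = enum_rank (Some (inl (inr (b, cf_q cM))) : bstate) ->
  exists2 t', t' <= t &
  let c' := iter t' (step inp) c in let cM' := iter t (step (inp1 Y)) cM in
  M_rep cM' c' /\ cf_q c' = enum_rank (Some (inl (inr (b, cf_q cM'))) : bstate).
Proof.
elim: t c cM => [|t IH] c cM rep eq; first by exists 0.
have [f|nf] := boolP (@final M (cf_q cM)).
  exists 0 => //=.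
  suff -> : iter t (step (inp1 Y)) cM = cM by rewrite /step f.
  by elim: t {IH} => //= t ->; rewrite /step f.
have [rep' eq'] := M_step rep eq nf.
have [t' l [r e]] := IH _ _ rep' eq'.
by exists t'.+1 => //; rewrite !iterSr.
Qed.

(** M reads the second input with the head that p has used, whence [hY s' = 0]. The two additional
    steps write the marks and turn the final state of M into a verdict. *)
Lemma build_call b s' b1 b' t2 :
  runs X Y p store0 (inl b) s' b1 -> hY s' = 0 -> tm_out M (inp1 Y) t2 = Some b' ->
  tm_out build inp (b1 + t2).+2 = Some (b == b').
Proof.
move=> [t tb e] hy eM.
have [rep brep eq] := dev_init.
have [rep' brep' eq'] := dev_exec e rep brep eq.
set c := iter t _ _ in rep' brep' eq'.
have rM0 : M_rep (init M (inp1 Y)) c by split; first by case: rep'; rewrite hy.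
have [t' l' []] := M_iter t2 rM0 eq'.
set c2 := iter t' _ _; set cM := iter t2 _ _ => _ eq2.
have fM : final (cf_q cM).
  by move: eM; rewrite /tm_out -/cM /final; case: eqP => //; case: eqP.
have eb : (cf_q cM == aM) = b'.
  by move: eM; rewrite /tm_out -/cM /=; case: eqP => [_ [] //|_]; case: eqP => // _ [].
apply: (@tm_out_mono _ _ (t' + t).+2); last by lia.
have {1}-> : (t' + t).+2 = ((1 + t') + t) + 1 by lia.
apply: tm_out_final; first by rewrite !iterD /=; reflexivity.
rewrite -/c -/c2 /step eq2 final_build.
by rewrite delta_build /bdelta enum_rankK fM /= eb.
Qed.

End Build.

(** * Programming constructs *)

Definition go (x y b p : move) : action := Action x y b p None None None None None.
Definition nop := go MStay MStay MStay MStay.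
Definition goX m := go m MStay MStay MStay.
Definition goY m := go MStay m MStay MStay.
Definition goB m := go MStay MStay m MStay.
Definition goP m := go MStay MStay MStay m.
Definition writeB m b := Action MStay MStay m MStay None None None (Some b) None.

Definition always (a : action) : program := basic (fun _ => (inl true, a)).
Definition halt (h : bool) : program := basic (fun _ => (inr h, nop)).
Definition need (h : bool) (c : reading -> bool) (a : action) : program :=
  basic (fun r => if c r then (inl true, a) else (inr h, nop)).
Definition test (c : reading -> bool) : program := basic (fun r => (inl (c r), nop)).
Definition quit (b : bool) : program := test (fun _ => b).
(** The body may exit with either flag, while [loop] goes on only after true; [quit true] makes the
    flag uniform. The test and this exit are the 2 in the cost b + 2 of a round. *)
Definition while (c : reading -> bool) (m : program) : program :=
  loop (ite (test c) (pseq m (quit true)) (quit false)).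

Fixpoint times (n : nat) (m : program) : program :=
  if n is n'.+1 then pseq m (times n' m) else quit true.

Lemma perform_nop s : perform nop s = s.
Proof. by case: s. Qed.

Section Rules.
Variables X Y : seq bool.
Notation look := (look X Y).

Definition does m s s' b := exists f, runs X Y m s (inl f) s' b.
Definition halts m s h b := exists s', runs X Y m s (inr h) s' b.

Lemma does_weaken m s s' b b' : does m s s' b -> b <= b' -> does m s s' b'.
Proof. by move=> [f r] l; exists f; apply: runs_weaken r l. Qed.

Lemma halts_weaken m s h b b' : halts m s h b -> b <= b' -> halts m s h b'.
Proof. by move=> [s' r] l; exists s'; apply: runs_weaken r l. Qed.

Lemma does_seq m m' s s1 s2 b1 b2 :
  does m s s1 b1 -> does m' s1 s2 b2 -> does (pseq m m') s s2 (b1 + b2).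
Proof. by move=> [f r] [f' r']; exists f'; apply: runs_seq r r'. Qed.

Lemma halts_seq m m' s s1 h b1 b2 :
  does m s s1 b1 -> halts m' s1 h b2 -> halts (pseq m m') s h (b1 + b2).
Proof. by move=> [f r] [s' r']; exists s'; apply: runs_seq r r'. Qed.

Lemma halts_seq1 m m' s h b1 : halts m s h b1 -> halts (pseq m m') s h b1.
Proof. by move=> [s' r]; exists s'; apply: runs_ite_halt. Qed.

Lemma does_always a s s' : perform a s = s' -> does (always a) s s' 1.
Proof. by move=> <-; exists true; exact: runs_basic. Qed.

Lemma halts_halt h s : halts (halt h) s h 1.
Proof. by exists (perform nop s); exact: runs_basic. Qed.

Lemma does_need h (c : reading -> bool) a s s' : c (look s) -> perform a s = s' ->
    does (need h c a) s s' 1.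
Proof. by move=> e <-; exists true; apply: runs_basic; rewrite e. Qed.

Lemma halts_need h (c : reading -> bool) a s : ~~ c (look s) -> halts (need h c a) s h 1.
Proof.
by move=> e; exists (perform nop s); apply: (@runs_basic _ _ _ _ _ nop); rewrite (negbTE e).
Qed.

Lemma runs_test (c : reading -> bool) s : runs X Y (test c) s (inl (c (look s))) s 1.
Proof. by rewrite -[s in X in runs _ _ _ _ _ X _]perform_nop; exact: runs_basic. Qed.

Lemma does_ite (c : reading -> bool) m1 m2 s s' b :
  does (if c (look s) then m1 else m2) s s' b -> does (ite (test c) m1 m2) s s' b.+1.
Proof. by move=> [f r]; exists f; rewrite -add1n; apply: runs_ite (runs_test c s) r. Qed.

Lemma halts_ite (c : reading -> bool) m1 m2 s h b :
  halts (if c (look s) then m1 else m2) s h b -> halts (ite (test c) m1 m2) s h b.+1.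
Proof. by move=> [s' r]; exists s'; rewrite -add1n; apply: runs_ite (runs_test c s) r. Qed.

Lemma runs_while (F : nat -> store) n (c : reading -> bool) m b :
  (forall i, i < n -> c (look (F i)) /\ does m (F i) (F i.+1) b) -> ~~ c (look (F n)) ->
  runs X Y (while c m) (F 0) (inl false) (F n) (n.+1 * (b + 2)).
Proof.
move=> H Hn; apply: runs_loop_iter => //.
- move=> i lin; have [ci [f r]] := H i lin.
  have := runs_test c (F i); rewrite ci => rt.
  have := runs_ite (m1 := pseq m (quit true)) (m2 := quit false) rt
      (runs_seq r (runs_test (fun _ => true) _)).
  by move=> r'; apply: runs_weaken r' _; lia.
have := runs_test c (F n); rewrite (negbTE Hn) => rt.
have := runs_ite (m1 := pseq m (quit true)) (m2 := quit false) rt (runs_test (fun _ => false) _).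
by move=> r'; apply: runs_weaken r' _; lia.
Qed.

Lemma does_while (F : nat -> store) n (c : reading -> bool) m b :
  (forall i, i < n -> c (look (F i)) /\ does m (F i) (F i.+1) b) -> ~~ c (look (F n)) ->
  does (while c m) (F 0) (F n) (n.+1 * (b + 2)).
Proof. by move=> H Hn; exists false; exact: runs_while. Qed.

Lemma halts_while (F : nat -> store) n (c : reading -> bool) m b h :
  (forall i, i < n -> c (look (F i)) /\ does m (F i) (F i.+1) b) ->
  c (look (F n)) -> halts m (F n) h b ->
  halts (while c m) (F 0) h (n.+1 * (b + 2)).
Proof.
move=> H Hn [s' r]; exists s'; apply: runs_loop_iter => //.
- move=> i lin; have [ci [f ri]] := H i lin.
  have := runs_test c (F i); rewrite ci => rt.
  have := runs_ite (m1 := pseq m (quit true)) (m2 := quit false) rt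
      (runs_seq ri (runs_test (fun _ => true) _)).
  by move=> r'; apply: runs_weaken r' _; lia.
have := runs_test c (F n); rewrite Hn => rt.
have := runs_ite (m1 := pseq m (quit true)) (m2 := quit false) rt (runs_ite_halt _ _ r).
by move=> r'; apply: runs_weaken r' _; lia.
Qed.

Lemma does_times (F : nat -> store) n m b :
  (forall i, i < n -> does m (F i) (F i.+1) b) -> does (times n m) (F 0) (F n) (n * b + 1).
Proof.
elim: n F => [|n IH] F H; first by exists true; exact: runs_test.
have r := IH (fun i => F i.+1) (fun i li => H i.+1 li).
by apply: does_weaken (does_seq (H 0 isT) r) _; lia.
Qed.

Lemma halts_times (F : nat -> store) n k m b h :
  (forall i, i < k -> does m (F i) (F i.+1) b) -> k < n -> halts m (F k) h b ->
  halts (times n m) (F 0) h (n * b).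
Proof.
elim: k n F => [|k IH] [|n] F H //= lt hk.
  by apply: halts_weaken (halts_seq1 _ hk) _; lia.
have r := IH n (fun i => F i.+1) (fun i li => H i.+1 li) lt hk.
by apply: halts_weaken (halts_seq (H 0 isT) r) _; lia.
Qed.

Definition rewX := while (fun r => ~~ lX r) (always (goX MLeft)).
Definition rewY := while (fun r => ~~ lY r) (always (goY MLeft)).
Definition rewB := while (fun r => ~~ lB r) (always (goB MLeft)).

Lemma does_rewX x y b p a c d B V :
  does rewX (Store x y b p a c d B V) (Store 0 y b p a c d B V) (x.+1 * 3).
Proof.
have := @does_while (fun i => Store (x - i) y b p a c d B V) x (fun r => ~~ lX r)
  (always (goX MLeft)) 1.
rewrite subn0 subnn; apply=> //= i li; split; first by rewrite subn_eq0 -ltnNge.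
by apply: does_always; rewrite /perform /= subnS.
Qed.

Lemma does_rewY x y b p a c d B V :
  does rewY (Store x y b p a c d B V) (Store x 0 b p a c d B V) (y.+1 * 3).
Proof.
have := @does_while (fun i => Store x (y - i) b p a c d B V) y (fun r => ~~ lY r)
  (always (goY MLeft)) 1.
rewrite subn0 subnn; apply=> //= i li; split; first by rewrite subn_eq0 -ltnNge.
by apply: does_always; rewrite /perform /= subnS.
Qed.

Lemma does_rewB x y b p a c d B V :
  does rewB (Store x y b p a c d B V) (Store x y 0 p a c d B V) (b.+1 * 3).
Proof.
have := @does_while (fun i => Store x y (b - i) p a c d B V) b (fun r => ~~ lB r)
  (always (goB MLeft)) 1.
rewrite subn0 subnn; apply=> //= i li; split; first by rewrite subn_eq0 -ltnNge.
by apply: does_always; rewrite /perform /= subnS.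
Qed.

End Rules.

Lemma symbol_nth s i : i < size s -> symbol s i = Some (nth false s i).
Proof. by move=> l; rewrite /symbol (nth_map false). Qed.

Lemma symbol_None s i : (symbol s i == None) = (size s <= i).
Proof.
case: leqP => l; last by rewrite symbol_nth.
by rewrite /symbol nth_default ?size_map.
Qed.

Lemma symbol_true s i : (symbol s i == Some true) = nth false s i.
Proof.
case: (ltnP i (size s)) => l; first by rewrite symbol_nth //; case: nth.
by rewrite nth_default // /symbol nth_default ?size_map.
Qed.

Lemma put_symbol s i b : i <= size s -> put (symbol s) i (Some b) = symbol (set_nth false s i b).
Proof.
move=> l; apply/funext=> j; rewrite /put.
have [e|ji] := eqVneq j i.
  by rewrite e symbol_nth ?nth_set_nth /= ?eqxx // size_set_nth; lia.
have [lj|gj] := ltnP j (size s).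
  rewrite !symbol_nth ?nth_set_nth /= ?(negbTE ji) // size_set_nth.
  by apply: leq_trans lj _; exact: leq_maxr.
have /eqP-> : symbol s j == None by rewrite symbol_None.
apply/esym/eqP; rewrite symbol_None size_set_nth /maxn; case: ifP; lia.
Qed.

Lemma set_nth_cat (u v : seq bool) b : set_nth false (u ++ v) (size u) b = u ++ b :: behead v.
Proof. by elim: u => [|c u IH] /=; [case: v | rewrite IH]. Qed.

(** * Binary counters, least significant bit first *)

Fixpoint incb (s : seq bool) : seq bool :=
  match s with [::] => [:: true] | false :: s => true :: s | true :: s => false :: incb s end.

(** The flag is the borrow out of the last bit. The length never changes, so 0 underflows to a
    string of ones. *)
Fixpoint decb (s : seq bool) : bool * seq bool :=
  match s with
  | [::] => (true, [::])
  | true :: s => (false, false :: s)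
  | false :: s => ((decb s).1, true :: (decb s).2)
  end.

Fixpoint bval (s : seq bool) : nat := if s is b :: s then b + 2 * bval s else 0.

Definition bits n := iter n incb [::].

Lemma bval_incb s : bval (incb s) = (bval s).+1.
Proof. by elim: s => [|[] s IH] //=; rewrite IH; lia. Qed.

Lemma bval_bits n : bval (bits n) = n.
Proof. by elim: n => // n IH; rewrite /bits iterS bval_incb -/(bits n) IH. Qed.

Lemma size_incb s : size (incb s) <= (size s).+1.
Proof. by elim: s => [|[] s IH] //=. Qed.

Lemma size_bits n : size (bits n) <= n.
Proof. by elim: n => // n IH; rewrite /bits iterS; apply: leq_trans (size_incb _) _. Qed.

Lemma size_decb s : size (decb s).2 = size s.
Proof. by elim: s => [|[] s IH] //=; rewrite IH. Qed.

Lemma decb_flag s : (decb s).1 = (bval s == 0).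
Proof. by elim: s => [|[] s IH] //=; rewrite IH; lia. Qed.

Lemma bval_decb s : 0 < bval s -> bval (decb s).2 = (bval s).-1.
Proof. by elim: s => [|[] s IH] //=; rewrite -?IH; lia. Qed.

Section Counters.
Variables X Y : seq bool.

Definition inc : program :=
  pseq rewB (pseq (while (fun r => rB r == Some true) (always (writeB MRight false)))
    (pseq (always (writeB MStay true)) rewB)).

Lemma does_inc x y b p a c d s V :
  does X Y inc (Store x y b p a c d (symbol s) V)
    (Store x y 0 p a c d (symbol (incb s)) V) (3 * b + 6 * size s + 10).
Proof.
pose k := find negb s.
(* Loop invariant: the first i bits, all 1 in s, have been turned into 0. *)
pose F i := Store x y i p a c d (symbol (nseq i false ++ drop i s)) V.
have F0 : Store x y 0 p a c d (symbol s) V = F 0 by rewrite /F drop0.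
have lek : k <= size s by exact: find_size.
have step i : i <= size s -> forall e,
  put (symbol (nseq i false ++ drop i s)) i (Some e) = symbol (nseq i false ++ e :: drop i.+1 s).
  move=> li e; rewrite put_symbol ?size_cat ?size_nseq ?leq_addr //.
  by rewrite -{3}(size_nseq i false) set_nth_cat -[behead _]drop1 drop_drop add1n.
have look_i i : i <= size s -> symbol (nseq i false ++ drop i s) i = symbol s i.
  move=> li; rewrite /symbol map_cat nth_cat size_map size_nseq ltnn subnn.
  by rewrite map_drop nth_drop addn0.
have R2 : does X Y (while (fun r => rB r == Some true) (always (writeB MRight false)))
    (F 0) (F k) (k.+1 * 3).
  apply: (@does_while X Y F k _ _ 1) => [i ik|] /=.
    rewrite look_i ?symbol_true; last lia.
    split; first by move/negbFE: (before_find false ik).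
    apply: does_always; rewrite /perform /= step; last lia.
    by rewrite /F -addn1 nseqD -catA.
  rewrite look_i // symbol_true.
  have [h|h] := boolP (has negb s); first exact: nth_find.
  by rewrite nth_default // /k hasNfind.
have R3 : does X Y (always (writeB MStay true)) (F k)
    (Store x y k p a c d (symbol (incb s)) V) 1.
  apply: does_always; rewrite /perform /= step // -/k.
  suff -> : nseq k false ++ true :: drop k.+1 s = incb s by [].
  by rewrite /k; elim: s {F F0 k lek step look_i R2} => [|[] s IH] //=; rewrite ?drop0 // -IH.
have R4 := does_rewB X Y x y k p a c d (symbol (incb s)) V.
have R1 := does_rewB X Y x y b p a c d (symbol s) V.
rewrite -F0 in R2.
by apply: does_weaken (does_seq R1 (does_seq R2 (does_seq R3 R4))) _; lia.
Qed.

End Counters.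

(** * The verifier for easy tables *)

(* Position of the common head of B and V, contents of V, accumulator. *)
Definition vm := (nat * (nat -> option bool) * bool)%type.

Definition is1 (c : option bool) : bool := c == Some true.

(** B is the input, V a memory addressed by the same head, and a the only register. Every
    instruction is local, so a machine executes it in a constant number of steps. *)
Definition token (B : nat -> option bool) (t : bool * bool * bool) (m : vm) : vm :=
  let: (p, V, a) := m in
  match t with
  | (false, false, false) => (p.-1, V, a)
  | (false, false, true) => (p.+1, V, a)
  | (false, true, false) => (p, V, is1 (B p))
  | (false, true, true) => (p, V, is1 (V p))
  | (true, false, false) => (p, V, a && is1 (V p))
  | (true, false, true) => (p, V, a || is1 (V p))
  | (true, true, false) => (p, V, ~~ a)
  | (true, true, true) => (p, put V p (Some a), a)
  end.

(** The first two bits of the token have been saved in C and D; the third is still under the head of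
    Y. *)
Definition token_action (r : reading) : action :=
  let act m a v := Action MStay MRight m MStay a None None None v in
  match rC r, rD r, is1 (rY r) with
  | false, false, false => act MLeft None None
  | false, false, true => act MRight None None
  | false, true, false => act MStay (Some (is1 (rB r))) None
  | false, true, true => act MStay (Some (is1 (rV r))) None
  | true, false, false => act MStay (Some (rA r && is1 (rV r))) None
  | true, false, true => act MStay (Some (rA r || is1 (rV r))) None
  | true, true, false => act MStay (Some (~~ rA r)) None
  | true, true, true => act MStay None (Some (rA r))
  end.

Definition bits3 (w : seq bool) (i : nat) : bool * bool * bool :=
  (nth false w (3 * i), nth false w (3 * i).+1, nth false w (3 * i).+2).

(** Rounded up: an incomplete last token is completed by zeros, which is also what [is1] yields on
    the blanks after w. Thus every string is a program. *)
Definition ntok (w : seq bool) : nat := (size w + 2) %/ 3.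

Definition run_upto (B : nat -> option bool) (w : seq bool) (n : nat) (m : vm) : vm :=
  iteri n (fun i => token B (bits3 w i)) m.

Definition run_tokens B w m := run_upto B w (ntok w) m.

Lemma run_upto_pos B w n p V a : (run_upto B w n (p, V, a)).1.1 <= p + n.
Proof.
elim: n => [|n IH] /=; first by rewrite addn0.
move: IH; rewrite /run_upto /=; case: (iteri _ _ _) => [[q V'] a'] /= IH.
by case: (nth _ _ _); case: (nth _ _ _); case: (nth _ _ _) => /=; lia.
Qed.

Definition token_prog : program :=
  pseq (while (fun r => rY r != None)
    (pseq (basic (fun r => (inl true, Action MStay MRight MStay MStay None (Some (is1 (rY r))) None
      None None)))
    (pseq (basic (fun r => (inl true, Action MStay MRight MStay MStay None None (Some (is1 (rY r)))
      None None)))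
          (basic (fun r => (inl true, token_action r))))))
  (always (Action MStay MStay MStay MStay None (Some false) (Some false) None None)).

Lemma does_basic X Y (f : reading -> action) s s' : perform (f (look X Y s)) s = s' ->
  does X Y (basic (fun r => (inl true, f r))) s s' 1.
Proof. by move=> <-; exists true; exact: runs_basic. Qed.

Section Tokens.
Variables T w : seq bool.

Lemma does_token_prog x b p a B V :
  let m := run_tokens B w (b, V, a) in
  does T w token_prog (Store x 0 b p a false false B V)
    (Store x (3 * ntok w) m.1.1 p m.2 false false B m.1.2) (5 * (ntok w) + 6).
Proof.
pose run i := run_upto B w i (b, V, a).
(* C and D keep the first two bits of the previous token until the next one overwrites them. *)
pose F i := Store x (3 * i) (run i).1.1 p (run i).2
  (if i is j.+1 then (bits3 w j).1.1 else false) (if i is j.+1 then (bits3 w j).1.2 else false) B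
    (run i).1.2.
have H := @does_while T w F (ntok w) (fun r => rY r != None).
apply: does_weaken (does_seq (H _ 3 _ _) (does_always _ _ (erefl _))) _; last by lia.
  move=> i li; split; first by rewrite /= symbol_None /ntok in li *; lia.
  rewrite /F -[3]/(1 + (1 + 1)).
  apply: does_seq (does_basic (erefl _)) (does_seq (does_basic (erefl _)) (does_basic _)).
  rewrite /perform /= /token_action /= /is1 !symbol_true /run /run_upto /= -/(run_upto _ _ _ _).
  case: (run_upto _ _ _ _) => [[q V'] a'] /=.
  have e : (3 * i).+3 = 3 * i.+1 by lia.
  rewrite -e.
  by case: (nth _ _ (3 * i)); case: (nth _ _ (3 * i).+1); case: (nth _ _ (3 * i).+2).
by rewrite /= negbK symbol_None /ntok; lia.
Qed.

Lemma does_steps x k b p a c d B V y :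
  does T w (times k (always (goX MRight))) (Store x y b p a c d B V)
    (Store (x + k) y b p a c d B V) (k + 1).
Proof.
have := @does_times T w (fun i => Store (x + i) y b p a c d B V) k (always (goX MRight)) 1.
rewrite addn0 muln1; apply=> i _; apply: does_always; by rewrite /perform /= addnS.
Qed.

(** Each bit of Y uses up a block of eight cells of X, of which only the first is tested. So the
    program goes through iff the block of the last bit of w starts inside T. *)
Definition length_prog : program :=
  while (fun r => rY r != None)
    (pseq (need false (fun r => rX r != None) (go MRight MRight MStay MStay))
      (times 7 (always (goX MRight)))).

(* The term [w == [::]] makes up for the truncation of [(size w).-1]: the empty program is short. *)
Definition short : bool := 8 * (size w).-1 < size T + (w == [::]).

Lemma length_prog_short b p a c d B V : short ->
  does T w length_prog (Store 0 0 b p a c d B V) (Store (8 * size w) (size w) b p a c d B V)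
    (11 * (size w).+1).
Proof.
move=> sh; rewrite [11 * _]mulnC.
apply: (@does_while T w (fun i => Store (8 * i) i b p a c d B V) _ _ _ 9).
  move=> i li; split; first by rewrite /= symbol_None; lia.
  rewrite -[9]/(1 + (7 + 1)).
  have e : 8 * i.+1 = (8 * i).+1 + 7 by lia.
  rewrite e; apply: does_seq (does_steps _ _ _ _ _ _ _ _ _ _).
  apply: does_need => //=; rewrite symbol_None.
  by move: sh; rewrite /short; case: (w) li => //= ? ? li; lia.
by rewrite /= negbK symbol_None.
Qed.

Lemma length_prog_long b p a c d B V : ~~ short ->
  halts T w length_prog (Store 0 0 b p a c d B V) false (11 * (size w).+1).
Proof.
(* Rounded up, |T|/8 is the first position in w whose block starts beyond T. *)
move=> sh; pose n := (size T + 7) %/ 8.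
have nw : n < size w.
  by move: sh; rewrite /short /n; case: (w) => [|? ?] /=; lia.
have := @halts_while T w (fun i => Store (8 * i) i b p a c d B V) n (fun r => rY r != None)
  (pseq (need false (fun r => rX r != None) (go MRight MRight MStay MStay))
      (times 7 (always (goX MRight)))) 9 false.
move=> H; apply: halts_weaken (H _ _ _) _; last lia.
- move=> i li; split; first by rewrite /= symbol_None; lia.
  rewrite -[9]/(1 + (7 + 1)).
  have e : 8 * i.+1 = (8 * i).+1 + 7 by lia.
  rewrite e; apply: does_seq (does_steps _ _ _ _ _ _ _ _ _ _).
  by apply: does_need => //=; rewrite symbol_None; lia.
- by rewrite /= symbol_None; lia.
- apply: halts_weaken (halts_seq1 _ (halts_need _ _ _)) _ => //=.
  by rewrite negbK symbol_None; lia.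
Qed.

(** |T| is counted twice: in binary on B, for the test of being a power of two and as the first
    input N + 0 of the simulation, and in unary by the head of P, as the budget for mismatches. *)
Definition count_prog : program :=
  while (fun r => rX r != None) (pseq (always (go MRight MStay MStay MRight)) inc).

Lemma does_count_prog a c d V :
  does T w count_prog (Store 0 0 0 0 a c d (fun _ => None) V)
    (Store (size T) 0 0 (size T) a c d (symbol (bits (size T))) V)
      ((size T).+1 * (6 * size T + 13)).
Proof.
have e0 : (fun _ => None) = symbol [::] by apply/funext => -[].
rewrite e0.
have e1 : 6 * size T + 13 = (6 * size T + 11) + 2 by lia.
rewrite e1.
apply: (@does_while T w (fun i => Store i 0 0 i a c d (symbol (bits i)) V) _ _ _ (6 * size T + 11)).
  move=> i li; split; first by rewrite /= symbol_None; lia.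
  have R1 : does T w (always (go MRight MStay MStay MRight))
      (Store i 0 0 i a c d (symbol (bits i)) V)
    (Store i.+1 0 0 i.+1 a c d (symbol (bits i)) V) 1 by exact: does_always.
  by apply: does_weaken (does_seq R1 (does_inc _ _ _ _ _ _ _ _ _ _ _)) _; have := size_bits i; lia.
by rewrite /= negbK symbol_None.
Qed.

(** The first 1 is the last bit, as in the little-endian expansion of a power of two. Without any 1
    the index is the size itself and the test fails. *)
Definition pow2b (s : seq bool) : bool := (index true s).+1 == size s.

Definition pow2_prog : program :=
  pseq (while (fun r => rB r == Some false) (always (goB MRight)))
  (pseq (need true (fun r => rB r != None) (goB MRight))
  (pseq (need true (fun r => rB r == None) nop) rewB)).

Lemma symbol_index s : symbol s (index true s) = if true \in s then Some true else None.
Proof.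
case: ifP => [h|/negbT h]; last by apply/eqP; rewrite symbol_None memNindex.
by rewrite symbol_nth ?index_mem // nth_index.
Qed.

Lemma does_pow_scan x y p a c d s V :
  does T w (while (fun r => rB r == Some false) (always (goB MRight)))
   (Store x y 0 p a c d (symbol s) V) (Store x y (index true s) p a c d (symbol s) V)
     ((size s).+1 * 3).
Proof.
apply: (@does_weaken _ _ _ _ _ ((index true s).+1 * 3)); last by rewrite leq_mul2r ltnS index_size.
apply: (@does_while T w (fun i => Store x y i p a c d (symbol s) V) _ _ _ 1).
  move=> i li; split; last exact: does_always.
  rewrite /= symbol_nth; last by apply: leq_trans li (index_size _ _).
  by have := before_find false li; rewrite /=; case: nth.
by rewrite /= symbol_index; case: ifP.
Qed.

Lemma does_pow2_prog x y p a c d s V : pow2b s ->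
  does T w pow2_prog (Store x y 0 p a c d (symbol s) V) (Store x y 0 p a c d (symbol s) V)
    (6 * size s + 12).
Proof.
move=> /eqP ps.
have ins : true \in s by rewrite -index_mem ps.
apply: does_weaken (does_seq (does_pow_scan _ _ _ _ _ _ _ _) (does_seq (does_need _ _ (erefl _))
   (does_seq (does_need _ _ (perform_nop _)) (does_rewB _ _ _ _ _ _ _ _ _ _ _)))) _ => /=.
- by rewrite symbol_index ins.
- by rewrite symbol_None ps.
- by lia.
Qed.

Lemma pow2_prog_not x y p a c d s V : ~~ pow2b s ->
  halts T w pow2_prog (Store x y 0 p a c d (symbol s) V) true (6 * size s + 12).
Proof.
move=> ps.
have R : halts T w (pseq (need true (fun r => rB r != None) (goB MRight))
    (pseq (need true (fun r => rB r == None) nop) rewB))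
    (Store x y (index true s) p a c d (symbol s) V) true 2.
  have [ins|ins] := boolP (true \in s).
    have R1 : does T w (need true (fun r => rB r != None) (goB MRight))
      (Store x y (index true s) p a c d (symbol s) V)
      (Store x y (index true s).+1 p a c d (symbol s) V) 1.
      by apply: does_need => //=; rewrite symbol_index ins.
    apply: halts_seq R1 (halts_seq1 _ (halts_need _ _ _)) => /=.
    by rewrite symbol_None; move: ps ins; rewrite /pow2b -index_mem eqn_leq; case: leqP.
  apply: (@halts_weaken _ _ _ _ _ 1) => //.
  by apply/halts_seq1/halts_need; rewrite /= symbol_index (negbTE ins).
by apply: halts_weaken (halts_seq (does_pow_scan _ _ _ _ _ _ _ _) R) _; lia.
Qed.

End Tokens.

(* Round [j] runs [w] on the binary expansion of [N + j]; V and the accumulator are left as the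
   previous round ended. *)
Fixpoint sim (w : seq bool) (N i : nat) : vm :=
  if i is j.+1 then
    run_tokens (symbol (bits (N + j))) w (0, (sim w N j).1.2, (sim w N j).2)
  else (0, fun _ => None, false).

Definition output (w : seq bool) (N i : nat) : bool := (sim w N i.+1).2.

Definition mismatch (T w : seq bool) (i : nat) : nat :=
  \sum_(0 <= j < i) (output w (size T) j != nth false T j).

(* Tables whose length is not a power of two are all accepted, so that an index determines the
   length of the table it refers to. *)
Definition verify (T w : seq bool) : bool :=
  short T w && (pow2b (bits (size T)) ==> (4 * mismatch T w (size T) <= size T)).

(* The head of P starts at cell |T| and moves four cells to the left at each mismatch. *)
Definition compare_prog : program :=
  ite (test (fun r => rX r == Some (rA r))) (quit true)
    (times 4 (need false (fun r => ~~ lP r) (goP MLeft))).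

Definition round_prog : program := pseq token_prog
  (pseq rewY (pseq compare_prog (pseq (always (goX MRight)) inc))).

Definition rounds_prog : program := while (fun r => rX r != None) round_prog.

Definition verify_prog : program :=
  pseq length_prog (pseq rewX (pseq rewY
    (pseq count_prog (pseq rewX (pseq pow2_prog (pseq rounds_prog (halt true))))))).

Section Verify.
Variables T w : seq bool.
Let N := size T.

(** The store at the start of round i. The truncated subtraction is exact as long as the table has
    not been rejected. *)
Let F i := Store i 0 0 (N - 4 * mismatch T w i) (sim w N i).2 false false
  (symbol (bits (N + i))) (sim w N i).1.2.

Lemma mismatch_leq i j : i <= j -> mismatch T w i <= mismatch T w j.
Proof. by move=> ij; rewrite /mismatch (big_cat_nat (n := i) (leq0n i) ij) /= leq_addr. Qed.

Lemma mismatchS i : mismatch T w i.+1 = mismatch T w i + (output w N i != nth false T i).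
Proof. by rewrite /mismatch big_nat_recr. Qed.

Let bnd := 30 * (size w + N + 3).

Lemma does_round_prog i : i < N -> 4 * mismatch T w i <= N ->
  if 4 * mismatch T w i.+1 <= N then does T w round_prog (F i) (F i.+1) bnd
  else halts T w round_prog (F i) false bnd.
Proof.
move=> iN mN.
have R1 := does_token_prog T w i 0 (N - 4 * mismatch T w i) (sim w N i).2 (symbol (bits (N + i)))
  (sim w N i).1.2.
have R2 := does_rewY T w i (3 * ntok w) (sim w N i.+1).1.1 (N - 4 * mismatch T w i) (sim w N i.+1).2
  false false (symbol (bits (N + i))) (sim w N i.+1).1.2.
have hp : (sim w N i.+1).1.1 <= size w + 1.
  apply: leq_trans (run_upto_pos _ _ _ _ _ _) _; rewrite /ntok; lia.
have hn : ntok w <= size w + 1 by rewrite /ntok; lia.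
pose G k := Store i 0 (sim w N i.+1).1.1 (N - 4 * mismatch T w i - k) (sim w N i.+1).2
  false false (symbol (bits (N + i))) (sim w N i.+1).1.2.
have G0 : G 0 = Store i 0 (sim w N i.+1).1.1 (N - 4 * mismatch T w i) (sim w N i.+1).2
  false false (symbol (bits (N + i))) (sim w N i.+1).1.2 by rewrite /G subn0.
rewrite -G0 in R2.
have cmpE : (rX (look T w (G 0)) == Some (rA (look T w (G 0)))) = (output w N i == nth false T i).
  rewrite /look /G /= symbol_nth // /output /= eq_sym.
  by apply/eqP/eqP => [[]|->].
have dec k : k < N - 4 * mismatch T w i ->
    does T w (need false (fun r => ~~ lP r) (goP MLeft)) (G k) (G k.+1) 1.
  move=> lk; apply: does_need => /=; first by rewrite subn_eq0 -ltnNge.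
  by rewrite /perform /G /= subnS.
have R5 q : does T w (pseq (always (goX MRight)) inc)
   (Store i 0 (sim w N i.+1).1.1 q (sim w N i.+1).2 false false (symbol (bits (N + i)))
     (sim w N i.+1).1.2)
   (Store i.+1 0 0 q (sim w N i.+1).2 false false (symbol (bits (N + i.+1))) (sim w N i.+1).1.2)
   (1 + (3 * (sim w N i.+1).1.1 + 6 * size (bits (N + i)) + 10)).
  rewrite addnS {2}/bits iterS -/(bits (N + i)).
  have R50 : does T w (always (goX MRight))
    (Store i 0 (sim w N i.+1).1.1 q (sim w N i.+1).2 false false (symbol (bits (N + i)))
      (sim w N i.+1).1.2)
    (Store i.+1 0 (sim w N i.+1).1.1 q (sim w N i.+1).2 false false (symbol (bits (N + i)))
      (sim w N i.+1).1.2) 1.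
    by exact: does_always.
  exact: does_seq R50 (does_inc _ _ _ _ _ _ _ _ _ _ _).
have sb := size_bits (N + i).
rewrite [F i.+1]/F mismatchS; case: (output w N i =P nth false T i) => [oe|on] /=.
  rewrite addn0 mN.
  have R4 : does T w compare_prog (G 0) (G 0) 2.
    by apply: does_ite; rewrite cmpE oe eqxx; exists true; exact: runs_test.
  rewrite {2}G0 in R4.
  by apply: does_weaken (does_seq R1 (does_seq R2 (does_seq R4 (R5 _)))) _; rewrite /bnd; lia.
case: leqP => h.
  have R4 : does T w compare_prog (G 0) (G 4) 6.
    apply: does_ite; rewrite cmpE; move/eqP/negbTE: on => ->.
    by apply: (@does_times _ _ G 4 _ 1) => k k4; apply: dec; lia.
  have e : N - 4 * (mismatch T w i + 1) = N - 4 * mismatch T w i - 4 by lia.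
  rewrite e; apply: does_weaken (does_seq R1 (does_seq R2 (does_seq R4 (R5 _)))) _.
  by rewrite /bnd; lia.
have R4 : halts T w compare_prog (G 0) false 5.
  apply: halts_ite; rewrite cmpE; move/eqP/negbTE: on => ->.
  apply: (@halts_times _ _ G 4 (N - 4 * mismatch T w i) _ 1) => [k k4||]; first exact: dec.
    by lia.
  by apply: halts_need; rewrite /= negbK subnn.
apply: halts_weaken (halts_seq R1 (halts_seq R2 (halts_seq1 _ R4))) _; rewrite /bnd; lia.
Qed.

Lemma rounds_prog_run :
  if 4 * mismatch T w N <= N then does T w rounds_prog (F 0) (F N) (N.+1 * (bnd + 2))
  else halts T w rounds_prog (F 0) false (N.+1 * (bnd + 2)).
Proof.
have [h|h] := leqP.
  apply: does_while => [i iN|]; last by rewrite /= negbK symbol_None.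
  have le j : j <= N -> 4 * mismatch T w j <= N by move=> jN; have := mismatch_leq jN; lia.
  split; first by rewrite /= symbol_None -ltnNge.
  by have := does_round_prog iN (le _ (ltnW iN)); rewrite le.
(* For the least such i = m, the rounds before m - 1 stay within the budget and round m - 1
   rejects. *)
have ex : exists i, N < 4 * mismatch T w i by exists N.
case: (ex_minnP ex) => m hm mmin.
have le j : j < m -> 4 * mismatch T w j <= N.
  by move=> jm; rewrite leqNgt; apply/negP => /mmin; lia.
have m0 : 0 < m by rewrite lt0n; apply: contraTN hm => /eqP ->; rewrite /mismatch big_geq.
have mN : m <= N := mmin _ h.
apply: (@halts_weaken _ _ _ _ _ (m.-1.+1 * (bnd + 2))); last by rewrite leq_mul2r; lia.
apply: halts_while => [i im||].
- split; first by rewrite /= symbol_None -ltnNge; lia.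
  by have := @does_round_prog i; rewrite !le; [apply|..]; lia.
- by rewrite /= symbol_None -ltnNge; lia.
- have := @does_round_prog m.-1; rewrite le; last lia.
  by rewrite prednK // (leqNgt (4 * mismatch T w m)) hm /=; apply; lia.
Qed.

Lemma verify_prog_run :
  halts T w verify_prog store0 (verify T w) (100 * (size w + N + 3) ^ 2).
Proof.
rewrite /verify; have [sh|/length_prog_long lg] := boolP (short T w); last first.
  by apply: halts_weaken (halts_seq1 _ (lg _ _ _ _ _ _ _)) _; lia.
have R1 := length_prog_short 0 0 false false false (fun _ => None) (fun _ => None) sh.
have R2 := does_rewX T w (8 * size w) (size w) 0 0 false false false (fun _ => None)
    (fun _ => None).
have R3 := does_rewY T w 0 (size w) 0 0 false false false (fun _ => None) (fun _ => None).
have R4 := does_count_prog T w false false false (fun _ => None).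
have R5 := does_rewX T w N 0 0 N false false false (symbol (bits N)) (fun _ => None).
have sb := size_bits N.
have hs m h b : halts T w m (Store 0 0 0 N false false false (symbol (bits N)) (fun _ => None)) h
  b ->
  b <= 30 * (size w + N + 3) ^ 2 + 40 * (size w + N + 3) ->
  halts T w (pseq length_prog (pseq rewX (pseq rewY (pseq count_prog (pseq rewX m))))) store0 h
    (100 * (size w + N + 3) ^ 2).
  move=> hm le.
  apply: halts_weaken (halts_seq R1 (halts_seq R2
    (halts_seq R3 (halts_seq R4 (halts_seq R5 hm))))) _.
  rewrite /bnd in le *; rewrite -/N; lia.
have bound : 6 * size (bits N) + 12 + (N.+1 * (bnd + 2) + 1)
    <= 30 * (size w + N + 3) ^ 2 + 40 * (size w + N + 3).
  have : N.+1 * (bnd + 2) <= (size w + N + 3) * (bnd + 2) by rewrite leq_mul2r; lia.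
  rewrite /bnd; set S := size w + N + 3.
  have -> : S * (30 * S + 2) = 30 * S ^ 2 + 2 * S by rewrite mulnDr mulnCA mulnn; lia.
  by rewrite /S; lia.
have [pw|pw] := boolP (pow2b _) => /=; last first.
  have Z := pow2_prog_not T w 0 0 N false false false (fun _ => None) pw.
  by apply: (hs _ _ _ (halts_seq1 (pseq rounds_prog (halt true)) Z) _); rewrite -/N; lia.
have R6 := does_pow2_prog T w 0 0 N false false false (fun _ => None) pw.
have EF : F 0 = Store 0 0 0 N false false false (symbol (bits N)) (fun _ => None).
  by rewrite /F /mismatch big_geq // subn0 addn0.
have := rounds_prog_run; rewrite EF; case: leqP => h R7.
  by apply: (hs _ _ _ (halts_seq R6 (halts_seq R7 (halts_halt _ _ _ _))) _); rewrite -/N; lia.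
by apply: (hs _ _ _ (halts_seq R6 (halts_seq1 _ R7)) _); rewrite -/N; lia.
Qed.

End Verify.

(** * Lexicographic comparison and table look-up *)

Fixpoint lcp (s t : seq bool) : nat :=
  match s, t with a :: s', b :: t' => if a == b then (lcp s' t').+1 else 0 | _, _ => 0 end.

Definition lexlt (s t : seq bool) : bool :=
  [&& size s == size t, is1 (symbol t (lcp s t)) & symbol s (lcp s t) == Some false].

Lemma lcp_before s t i : i < lcp s t -> (symbol s i == symbol t i) && (symbol s i != None).
Proof.
elim: s t i => [|a s IH] [|b t] //= i.
case: eqP => // -> ; case: i => [|i] //= li; first by rewrite /symbol /= eqxx.
by have := IH t i li.
Qed.

Lemma lcp_at s t : ~~ ((symbol s (lcp s t) == symbol t (lcp s t)) && (symbol s (lcp s t) != None)).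
Proof.
elim: s t => [|a s IH] [|b t] //=.
have [_|ab] := eqVneq a b; first exact: IH.
by rewrite /symbol /=; case: a b ab => -[].
Qed.

Lemma lcp_size s t : lcp s t <= minn (size s) (size t).
Proof.
elim: s t => [|a s IH] [|b t] //=; case: eqP => // _.
by have := IH t; lia.
Qed.

Lemma lcp_refl s : lcp s s = size s.
Proof. by elim: s => //= a s ->; rewrite eqxx. Qed.

Lemma lcp_eq s t : symbol s (lcp s t) == None -> symbol t (lcp s t) == None -> s = t.
Proof.
elim: s t => [|a s IH] [|b t] //=; have [->|_] //= := eqVneq a b => hs ht.
by rewrite (IH t).
Qed.

Lemma lcpC s t : lcp s t = lcp t s.
Proof. by elim: s t => [|a s IH] [|b t] //=; rewrite eq_sym IH. Qed.

(** Big-endian, unlike [bval], so that the lexicographic order on tables of one length becomes the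
    order of numbers. *)
Fixpoint mval (s : seq bool) : nat := if s is b :: s' then b * 2 ^ size s' + mval s' else 0.

Lemma mval_lt s : mval s < 2 ^ size s.
Proof. by elim: s => //= b s IH; rewrite expnS; case: b; lia. Qed.

Lemma mval_inj s t : size s = size t -> mval s = mval t -> s = t.
Proof.
elim: s t => [|a s IH] [|b t] //= [e]; rewrite e => h.
have := mval_lt s; have := mval_lt t; rewrite e => ht hs.
have ab : a = b by case: a b h => -[] //=; rewrite mul1n mul0n; lia.
by rewrite ab in h *; rewrite (IH t) //; lia.
Qed.

Lemma lexlt_mval s t : size s = size t -> lexlt s t = (mval s < mval t).
Proof.
rewrite /lexlt => e; rewrite e eqxx /=.
elim: s t e => [|a s IH] [|b t] //= [e].
have := mval_lt s; have := mval_lt t; rewrite e => ht hs.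
have [->|ab] := eqVneq a b; first by rewrite ltn_add2l -IH.
by rewrite /is1 /symbol /=; case: a b ab => -[] // _; rewrite ?eqxx ?mul1n ?mul0n /=; lia.
Qed.

Definition both_end (r : reading) : bool := (rX r == None) && (rY r == None).

Definition setA (b : bool) : action :=
  Action MStay MStay MStay MStay (Some b) None None None None.

Definition advance : program := always (go MRight MRight MStay MStay).

Definition skip_equal : program := while (fun r => (rX r == rY r) && (rX r != None)) advance.

Definition skip_both : program := while (fun r => (rX r != None) && (rY r != None)) advance.

Definition lex_branch : program :=
  ite (test both_end) (always (setA true))
    (need false (fun r => is1 (rX r) && (rY r == Some false)) (setA false)).

Definition lex_tail : program :=
  pseq skip_both (pseq (need false both_end nop) (pseq rewY (test rA))).

(** The exit flag is the answer required from the machine that is called on Y: true if Y = X, false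
    if Y precedes X. The lengths are compared only after the first difference has been found, with
    the outcome kept in A. *)
Definition lex_prog : program := pseq skip_equal (pseq lex_branch lex_tail).

Section Compare.
Variables X Y : seq bool.

Let k := lcp X Y.
Let S i a := Store i i 0 0 a false false (fun _ => None) (fun _ => None).

Lemma lex_eqE : both_end (look X Y (S k false)) = (X == Y).
Proof.
rewrite /both_end /=; apply/idP/eqP => [/andP[]|e]; first exact: lcp_eq.
by rewrite /k -e lcp_refl symbol_None leqnn.
Qed.

Lemma does_skip_equal : does X Y skip_equal store0 (S k false) (k.+1 * 3).
Proof.
apply: (@does_while X Y (fun i => S i false) k _ _ 1) => [i ik|]; last exact: lcp_at.
by split; [exact: lcp_before | exact: does_always].
Qed.

Lemma does_skip_both a :
  does X Y skip_both (S k a) (S (minn (size X) (size Y)) a) ((minn (size X) (size Y)).+1 * 3).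
Proof.
have lk : k <= minn (size X) (size Y) by exact: lcp_size.
apply: (@does_weaken _ _ _ _ _ ((minn (size X) (size Y) - k).+1 * 3)); last by lia.
have := @does_while X Y (fun i => S (k + i) a) (minn (size X) (size Y) - k)
  (fun r => (rX r != None) && (rY r != None)) advance 1.
rewrite addn0 subnKC //; apply=> [i ik|]; last by rewrite /= !symbol_None; lia.
by split; [rewrite /= !symbol_None; lia | apply: does_always; rewrite /perform /= addnS].
Qed.

Let bnd := 20 * (size Y + 3).

Lemma runs_lex_tail a : size X = size Y ->
  runs X Y lex_tail (S k a) (inl a)
   (Store (size X) 0 0 0 a false false (fun _ => None) (fun _ => None)) (6 * size Y + 8).
Proof.
move=> e; have := does_skip_both a; rewrite e minnn => -[f R3].
have [f1 R4] : does X Y (need false both_end nop) (S (size Y) a) (S (size Y) a) 1.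
  by apply: does_need (perform_nop _); rewrite /both_end /= !symbol_None e leqnn.
have [f2 R5] := does_rewY X Y (size Y) (size Y) 0 0 a false false (fun _ => None) (fun _ => None).
by apply: runs_weaken (runs_seq R3 (runs_seq R4 (runs_seq R5 (runs_test _ _ _ _)))) _; lia.
Qed.

Lemma lex_prog_run :
  if X == Y then exists2 s, runs X Y lex_prog store0 (inl true) s bnd & hY s = 0
  else if lexlt Y X then exists2 s, runs X Y lex_prog store0 (inl false) s bnd & hY s = 0
  else halts X Y lex_prog store0 false bnd.
Proof.
have lk : k <= minn (size X) (size Y) by exact: lcp_size.
have [f1 R1] := does_skip_equal.
have [xy|xy] := boolP (X == Y); rewrite -lex_eqE in xy.
  have e : size X = size Y by move: xy; rewrite lex_eqE => /eqP ->.
  have [f2 R2] : does X Y lex_branch (S k false) (S k true) 2.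
    by apply: does_ite; rewrite xy; exact: does_always.
  eexists; first apply: runs_weaken (runs_seq R1 (runs_seq R2 (runs_lex_tail true e))) _;
    rewrite // /bnd; lia.
have R2 (h : is1 (symbol X k) && (symbol Y k == Some false)) :
    does X Y lex_branch (S k false) (S k false) 2.
  by apply: does_ite; rewrite (negbTE xy); exact: does_need.
rewrite /lexlt lcpC -/k; have [e|e] /= := eqVneq (size Y) (size X).
  have [h|h] := boolP (is1 _ && _).
    have [f2 {}R2] := R2 h.
    eexists; first apply: runs_weaken (runs_seq R1 (runs_seq R2 (runs_lex_tail false (esym e)))) _;
      rewrite // /bnd; lia.
  apply: halts_weaken (halts_seq does_skip_equal (halts_seq1 _ (halts_ite (b := 1) _))) _.
    by rewrite (negbTE xy); exact: halts_need.
  by rewrite /bnd; lia.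
have [h|h] := boolP (is1 (symbol X k) && (symbol Y k == Some false)); last first.
  apply: halts_weaken (halts_seq does_skip_equal (halts_seq1 _ (halts_ite (b := 1) _))) _.
    by rewrite (negbTE xy); exact: halts_need.
  by rewrite /bnd; lia.
apply: halts_weaken (halts_seq does_skip_equal (halts_seq (R2 h)
  (halts_seq (does_skip_both false) (halts_seq1 _ (halts_need _ _ _))))) _.
  by rewrite /both_end /= !symbol_None; lia.
by rewrite /bnd; lia.
Qed.

End Compare.

(** * Table look-up with a decreasing counter *)

Definition dec : program :=
  pseq (while (fun r => rB r == Some false) (always (writeB MRight true)))
  (pseq (ite (test (fun r => rB r == None)) (always (setA true))
     (always (Action MStay MStay MStay MStay (Some false) None None (Some false) None))) rewB).

Lemma does_dec X Y x y p a c d s V :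
  does X Y dec (Store x y 0 p a c d (symbol s) V)
    (Store x y 0 p (decb s).1 c d (symbol (decb s).2) V) (6 * size s + 12).
Proof.
pose k := index true s.
have lek : k <= size s by exact: index_size.
pose F i := Store x y i p a c d (symbol (nseq i true ++ drop i s)) V.
have F0 : Store x y 0 p a c d (symbol s) V = F 0 by rewrite /F drop0.
have step i : i <= size s -> forall e,
  put (symbol (nseq i true ++ drop i s)) i (Some e) = symbol (nseq i true ++ e :: drop i.+1 s).
  move=> li e; rewrite put_symbol ?size_cat ?size_nseq ?leq_addr //.
  by rewrite -{3}(size_nseq i true) set_nth_cat -[behead _]drop1 drop_drop add1n.
have look_i i : i <= size s -> symbol (nseq i true ++ drop i s) i = symbol s i.
  move=> li; rewrite /symbol map_cat nth_cat size_map size_nseq ltnn subnn.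
  by rewrite map_drop nth_drop addn0.
have R2 : does X Y (while (fun r => rB r == Some false) (always (writeB MRight true)))
    (F 0) (F k) (k.+1 * 3).
  apply: (@does_while X Y F k _ _ 1) => [i ik|] /=.
    rewrite look_i; last lia.
    split; first by rewrite symbol_nth; [have := before_find false ik; rewrite /=; case: nth|lia].
    apply: does_always; rewrite /perform /= step; last lia.
    by rewrite /F -addn1 nseqD -catA.
  by rewrite look_i // symbol_index; case: ifP.
have R3 : does X Y (ite (test (fun r => rB r == None)) (always (setA true))
     (always (Action MStay MStay MStay MStay (Some false) None None (Some false) None))) (F k)
    (Store x y k p (decb s).1 c d (symbol (decb s).2) V) 2.
  apply: does_ite => /=; rewrite look_i // symbol_index.
  case: (boolP (true \in s)) => ts /=; apply: does_always; rewrite /perform /F /=.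
    rewrite step //.
    have -> : (decb s).1 = false by move: ts; elim: (s) => [|[] s' IH].
    congr (Store _ _ _ _ _ _ _ (symbol _) _).
    by rewrite /k; elim: s ts {F F0 k lek step look_i R2} => [|[] s IH] //=;
      rewrite ?drop0 // => /IH ->.
  have -> : (decb s).1 = true by move: ts; elim: (s) => [|[] s' IH].
  rewrite /put /=; congr (Store _ _ _ _ _ _ _ (symbol _) _).
  by rewrite /k; elim: s ts {F F0 k lek step look_i R2} => [|[] s IH] //= /IH ->.
have R4 := does_rewB X Y x y k p (decb s).1 c d (symbol (decb s).2) V.
rewrite -F0 in R2.
by apply: does_weaken (does_seq R2 (does_seq R3 R4)) _; lia.
Qed.

(** The index stands on a read-only tape but has to be decremented. *)
Definition copy_prog : program :=
  while (fun r => rX r != None)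
    (basic (fun r =>
      (inl true, Action MRight MStay MRight MStay None None None (Some (is1 (rX r))) None))).

(** The index v is reduced by one for each cell of Y, with rejection on underflow; what remains, v -
    N, is then walked off from the left end of Y, one cell per decrement. Exit flag false means that
    the machine called on Y must answer false. *)
Definition index_prog : program :=
  pseq copy_prog (pseq rewB
  (pseq (while (fun r => rY r != None) (pseq dec (need false (fun r => ~~ rA r) (goY MRight))))
  (pseq rewY (pseq dec
  (pseq (while (fun r => ~~ rA r) (pseq (always (goY MRight)) dec))
  (pseq (need false (fun r => is1 (rY r)) nop) (pseq rewY (quit false)))))))).

Section Index.
Variables x T : seq bool.
Let N := size T.
Let n := size x.
Let v := bval x.

Definition selects : bool := (N <= v) && nth false T (v - N).

Lemma does_copy_prog :
  does x T copy_prog store0 (Store n 0 n 0 false false false (symbol x) (fun _ => None)) (n.+1 * 3).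
Proof.
pose F i := Store i 0 i 0 false false false (symbol (take i x)) (fun _ => None).
have e0 : store0 = F 0 by rewrite /F take0 /store0; congr Store; apply/funext => -[].
rewrite e0 -{2}[x]take_size.
apply: (@does_while x T F n _ _ 1) => [i li|]; last by rewrite /= negbK symbol_None.
split; first by rewrite /= symbol_None -ltnNge.
apply: does_basic; rewrite /perform /F /= put_symbol ?size_takel //; last exact: ltnW.
congr (Store _ _ _ _ _ _ _ (symbol _) _).
rewrite /is1 symbol_true (take_nth false) // -{1}(cats0 (take i x)).
by rewrite -{2}(size_takel (ltnW li)) set_nth_cat cats1.
Qed.

Let s i := iter i (fun s => (decb s).2) x.

Lemma size_s i : size (s i) = n.
Proof. by elim: i => //= i IH; rewrite size_decb. Qed.

Lemma bval_s i : i <= v -> bval (s i) = v - i.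
Proof.
elim: i => [|i IH] li; first by rewrite subn0.
by rewrite /s iterS bval_decb -/(s i) IH; lia.
Qed.

Lemma flag_s i : i <= v -> (decb (s i)).1 = (i == v).
Proof. by move=> li; rewrite decb_flag bval_s //; lia. Qed.

Let G y i a := Store n y 0 0 a false false (symbol (s i)) (fun _ => None).

Lemma does_decG y i a : does x T dec (G y i a) (G y i.+1 (decb (s i)).1) (6 * n + 12).
Proof. by rewrite -(size_s i); exact: does_dec. Qed.

Let L1 := while (fun r => rY r != None) (pseq dec (need false (fun r => ~~ rA r) (goY MRight))).

Lemma index1_step i : i < v ->
  does x T (pseq dec (need false (fun r => ~~ rA r) (goY MRight)))
    (G i i false) (G i.+1 i.+1 false) (6 * n + 13).
Proof.
move=> li; have R := does_decG i i false; rewrite flag_s in R; last lia.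
have e : (i == v) = false by lia.
rewrite e in R.
by apply: does_weaken (does_seq R (does_need _ _ _)) _ => //; lia.
Qed.

Lemma index1_ok : N <= v -> does x T L1 (G 0 0 false) (G N N false) (N.+1 * (6 * n + 15)).
Proof.
move=> le; have -> : 6 * n + 15 = (6 * n + 13) + 2 by lia.
apply: (@does_while x T (fun i => G i i false)) => [i li|]; last by rewrite /= negbK symbol_None.
by split; [rewrite /= symbol_None -ltnNge | apply: index1_step; lia].
Qed.

Lemma index1_fail : v < N -> exists b, halts x T L1 (G 0 0 false) false b.
Proof.
move=> lt; exists (v.+1 * ((6 * n + 13) + 2)).
apply: (@halts_while x T (fun i => G i i false)) => [i li||].
- by split; [rewrite /= symbol_None -ltnNge; lia | exact: index1_step].
- by rewrite /= symbol_None -ltnNge.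
- have R := does_decG v v false; rewrite flag_s // eqxx in R.
  by apply: halts_weaken (halts_seq R (halts_need _ _ _)) _ => //; lia.
Qed.

Lemma index2 j : N + j = v ->
  does x T (while (fun r => ~~ rA r) (pseq (always (goY MRight)) dec)) (G 0 N.+1 (N == v))
    (G j v.+1 true) (j.+1 * (6 * n + 15)).
Proof.
move=> e; have -> : 6 * n + 15 = (6 * n + 13) + 2 by lia.
(* The counter is one decrement ahead of the head of Y, so A tells on arrival at position i whether
   i = v - N. *)
have := @does_while x T (fun i => G i (N + i).+1 (N + i == v)) j (fun r => ~~ rA r)
  (pseq (always (goY MRight)) dec) (6 * n + 13).
rewrite addn0 e eqxx; apply=> // i li; split; first by rewrite /=; lia.
rewrite addnS.
have R1 : does x T (always (goY MRight)) (G i (N + i).+1 (N + i == v))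
    (G i.+1 (N + i).+1 (N + i == v)) 1.
  exact: does_always.
have R2 := does_decG i.+1 (N + i).+1 (N + i == v); rewrite flag_s in R2; last lia.
by apply: does_weaken (does_seq R1 R2) _; lia.
Qed.

(** Rejection may take any time: by [tm_out_inj] it excludes acceptance at all times, and membership
    in NP bounds only accepting runs. *)
Lemma index_prog_run :
  if selects then
    exists2 s, runs x T index_prog store0 (inl false) s (100 * (n + N + 3) ^ 2) & hY s = 0
  else exists b, halts x T index_prog store0 false b.
Proof.
have R1 := does_copy_prog.
have R2 := does_rewB x T n 0 n 0 false false false (symbol x) (fun _ => None).
rewrite /selects; case: leqP => /= [Nv|vN]; last first.
  by have [b R3] := index1_fail vN; eexists; apply: halts_seq R1 (halts_seq R2 (halts_seq1 _ R3)).
have R3 := index1_ok Nv.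
have R4 := does_rewY x T n N 0 0 false false false (symbol (s N)) (fun _ => None).
have R5 := does_decG 0 N false; rewrite flag_s // in R5.
have R6 := index2 (subnKC Nv).
case: ifP => h; last first.
  eexists; apply: halts_seq R1 (halts_seq R2
    (halts_seq R3 (halts_seq R4 (halts_seq R5 (halts_seq R6 (halts_seq1 _ (halts_need _ _ _))))))).
  by rewrite /is1 /= symbol_true h.
have [f R7] : does x T (need false (fun r => is1 (rY r)) nop)
    (G (v - N) v.+1 true) (G (v - N) v.+1 true) 1.
  by apply: does_need (perform_nop _); rewrite /is1 /= symbol_true.
have [f' R8] := does_rewY x T n (v - N) 0 0 true false false (symbol (s v.+1)) (fun _ => None).
(* A 1 at position v - N lies inside T, which bounds the second walk. *)
have jN : v - N < N by rewrite ltnNge; apply: contraTN h => l; rewrite nth_default.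
have [f1 S1] := R1. have [f2 S2] := R2. have [f3 S3] := R3. have [f4 S4] := R4.
have [f5 S5] := R5. have [f6 S6] := R6.
eexists; first apply: runs_weaken (runs_seq S1
  (runs_seq S2 (runs_seq S3 (runs_seq S4
  (runs_seq S5 (runs_seq S6 (runs_seq R7 (runs_seq R8 (runs_test _ _ _ _))))))))) _ => //.
have : (v - N).+1 * (6 * n + 15) <= N.+1 * (6 * n + 15) by rewrite leq_mul2r; lia.
have : N.+1 * (6 * n + 15) <= (n + N + 3) * (6 * (n + N + 3)) by rewrite leq_mul; lia.
rewrite mulnCA mulnn; lia.
by [].
Qed.

End Index.

(** * Circuits as token programs *)

Definition encode (ts : seq (bool * bool * bool)) : seq bool :=
  flatten [seq [:: t.1.1; t.1.2; t.2] | t <- ts].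

Lemma size_encode ts : size (encode ts) = 3 * size ts.
Proof. by elim: ts => //= t ts; rewrite /encode /= => ->; lia. Qed.

Lemma bits3_encode t0 ts i : i < size ts -> bits3 (encode ts) i = nth t0 ts i.
Proof.
elim: ts i => [|[[a b] c] ts IH] [|i] //= li.
have e : 3 * i.+1 = (3 * i).+3 by lia.
by rewrite /bits3 e /= -IH.
Qed.

Definition run_list B (m : vm) ts := foldl (fun m t => token B t m) m ts.

Lemma run_tokens_encode B ts m : run_tokens B (encode ts) m = run_list B m ts.
Proof.
have -> : run_tokens B (encode ts) m = run_upto B (encode ts) (size ts) m.
  by rewrite /run_tokens /ntok size_encode; congr run_upto; lia.
rewrite -{3}(take_size ts).
have : size ts <= size ts by [].
elim: {1 3 4}(size ts) => [|k IH] lk; first by rewrite take0.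
rewrite (take_nth (false, false, false)) // /run_list foldl_rcons -/(run_list _ _ _) -IH;
  last exact: ltnW.
by rewrite -bits3_encode.
Qed.

Definition tL := (false, false, false).
Definition tR := (false, false, true).
Definition tLoadB := (false, true, false).
Definition tLoadV := (false, true, true).
Definition tAnd := (true, false, false).
Definition tOr := (true, false, true).
Definition tNot := (true, true, false).
Definition tW := (true, true, true).

Section Compile.
Variable Z : nat.

(* The left moves stop at cell 0, so this reaches cell q from any cell up to Z. *)
Definition goto (q : nat) := nseq Z tL ++ nseq q tR.

(** Cell i of V is the place for the value of vertex i, so each operand is fetched by one [goto]. *)
Definition gate_tokens (i : nat) (v : vertex) :=
  match v with
  | VIn k => rcons (goto k) tLoadB
  | VAnd a b => rcons (goto a) tLoadV ++ rcons (goto b) tAnd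
  | VOr a b => rcons (goto a) tLoadV ++ rcons (goto b) tOr
  | VNot a => goto a ++ [:: tLoadV; tNot]
  end ++ rcons (goto i) tW.

Fixpoint compile (i : nat) (vs : seq vertex) :=
  if vs is v :: vs' then gate_tokens i v ++ compile i.+1 vs' else [::].

Variables (B : nat -> option bool) (x : seq bool).
Hypothesis Bx : forall k, is1 (B k) = nth false x k.

Lemma run_list_cat m s t : run_list B m (s ++ t) = run_list B (run_list B m s) t.
Proof. exact: foldl_cat. Qed.

Lemma run_goto p q V a : p <= Z -> run_list B (p, V, a) (goto q) = (q, V, a).
Proof.
move=> pZ; rewrite run_list_cat.
have -> : run_list B (p, V, a) (nseq Z tL) = (0, V, a).
  have -> : (0, V, a) = (p - Z, V, a) :> vm by congr (_, _, _); lia.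
  elim: Z p {pZ} => [|z IH] p /=; first by rewrite subn0.
  by rewrite /run_list /= -/(run_list _ _ _) IH; congr (_, _, _); lia.
have -> : (q, V, a) = (0 + q, V, a) :> vm by [].
elim: q 0 => [|q IH] r /=; first by rewrite addn0.
by rewrite /run_list /= -/(run_list _ _ _) IH addSnnS.
Qed.

Definition vertex_small (i : nat) (v : vertex) : bool :=
  match v with VIn k => k <= Z | VAnd a b | VOr a b => (a < i) && (b < i) | VNot a => a < i end.

(** Nothing is said about the cells from [size vals] on, which may contain values from earlier
    runs. *)
Definition holds (V : nat -> option bool) (vals : seq bool) : Prop :=
  forall i, i < size vals -> is1 (V i) = nth false vals i.

Lemma run_gate p V a vals v :
  p <= Z -> size vals <= Z -> vertex_small (size vals) v -> holds V vals ->
  exists p' V', run_list B (p, V, a) (gate_tokens (size vals) v) = (p', V', eval_vertex x vals v) /\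
    p' <= Z /\ holds V' (rcons vals (eval_vertex x vals v)).
Proof.
move=> pZ sZ ok hV.
exists (size vals), (put V (size vals) (Some (eval_vertex x vals v))); split; last split=> //.
  have gW q b : q <= Z -> run_list B (q, V, b) (rcons (goto (size vals)) tW) =
      (size vals, put V (size vals) (Some b), b).
    by move=> qZ; rewrite -cats1 run_list_cat run_goto.
  have gV q b r : q <= Z -> r < size vals ->
      run_list B (q, V, b) (rcons (goto r) tLoadV) = (r, V, nth false vals r).
    by move=> qZ rs; rewrite -cats1 run_list_cat run_goto //= -hV.
  rewrite /gate_tokens run_list_cat.
  case: v ok => [k|a1 b1|a1 b1|a1] /= => [kZ|/andP[l1 l2]|/andP[l1 l2]|l1].
  - rewrite -[rcons (goto k) _]cats1 run_list_cat run_goto //= Bx.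
    exact: gW.
  - rewrite run_list_cat gV // -[rcons (goto b1) _]cats1 run_list_cat run_goto //=; last by lia.
    rewrite hV //; apply: gW; lia.
  - rewrite run_list_cat gV // -[rcons (goto b1) _]cats1 run_list_cat run_goto //=; last by lia.
    rewrite hV //; apply: gW; lia.
  - rewrite run_list_cat run_goto //= hV //; apply: gW; lia.
move=> i; rewrite size_rcons nth_rcons /put => li.
have [->|ne] := eqVneq i (size vals); first by rewrite ltnn; case: eval_vertex.
by rewrite ifT; [apply: hV|]; lia.
Qed.

Lemma run_compile p V a vals vs : p <= Z -> size vals + size vs <= Z ->
  (forall i, i < size vs -> vertex_small (size vals + i) (nth (VIn 0) vs i)) -> holds V vals ->
  0 < size vs ->
  (run_list B (p, V, a) (compile (size vals) vs)).2 =
  last false (foldl (fun vals v => rcons vals (eval_vertex x vals v)) vals vs).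
Proof.
elim: vs p V a vals => // v vs IH p V a vals pZ sZ ok hV _.
rewrite /= run_list_cat.
have sv : size vals <= Z by move: sZ => /=; lia.
have v0 := ok 0 isT; rewrite addn0 /= in v0.
have [p' [V' [-> [p'Z hV']]]] := run_gate a pZ sv v0 hV.
have [/size0nil ->|ne] := posnP (size vs); first by rewrite /= last_rcons.
rewrite -(size_rcons vals (eval_vertex x vals v)); apply: IH => //.
  by rewrite size_rcons; move: sZ => /=; lia.
by move=> i li; rewrite size_rcons addSnnS; apply: (ok i.+1).
Qed.

Lemma size_goto q : q <= Z -> size (goto q) <= 2 * Z.
Proof. by rewrite size_cat !size_nseq; lia. Qed.

Lemma size_compile i vs : i + size vs <= Z ->
  (forall j, j < size vs -> vertex_small (i + j) (nth (VIn 0) vs j)) ->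
  size (compile i vs) <= size vs * (6 * Z + 3).
Proof.
elim: vs i => //= v vs IH i iZ ok.
rewrite size_cat mulSn; apply: leq_add; last first.
  by apply: IH => [|j lj]; [lia | rewrite addSnnS; apply: (ok j.+1)].
have := ok 0 isT; rewrite addn0 /gate_tokens size_cat size_rcons /=.
have g q : q <= Z -> size (goto q) <= 2 * Z by exact: size_goto.
have iZ' : i <= Z by lia.
have := g i iZ'; case: v {ok} => [k|a b|a b|a] /= hi; rewrite ?size_cat ?size_rcons ?size_nseq /=.
- by move=> /g; lia.
- by move=> /andP[la lb]; have /g := ltnW (leq_trans la iZ'); have /g := ltnW (leq_trans lb iZ');
  lia.
- by move=> /andP[la lb]; have /g := ltnW (leq_trans la iZ'); have /g := ltnW (leq_trans lb iZ');
  lia.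
- by move=> la; have /g := ltnW (leq_trans la iZ'); lia.
Qed.

End Compile.

(** Z bounds all addresses. A gate takes at most 6Z + 3 <= 9Z tokens of three bits, and there are at
    most Z vertices. V and a are arbitrary because the simulation does not clear them between
    rounds; s will be the unpadded form of x. *)
Lemma circuit_tokens (C : circuit) (Z : nat) : circuit_wf C -> size (c_vs C) <= Z -> c_n C <= Z ->
  exists2 w, size w <= 27 * Z ^ 2 &
    forall s x V a, (forall k, nth false s k = nth false x k) ->
      (run_tokens (symbol s) w (0, V, a)).2 = last false (circuit_vals C x).
Proof.
move=> /and3P[s0 /allP ok _] sZ nZ.
have small j : j < size (c_vs C) -> vertex_small Z (0 + j) (nth (VIn 0) (c_vs C) j).
  move=> lj; have := ok j; rewrite mem_iota lj => /(_ isT).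
  by case: nth => [k|a b|a b|a] //=; [lia | case/and3P=> -> -> | case/and3P=> -> ->].
exists (encode (compile Z 0 (c_vs C))).
  rewrite size_encode; have := size_compile (i := 0) sZ small.
  have : size (c_vs C) * (6 * Z + 3) <= Z * (9 * Z) by apply: leq_mul; lia.
  by rewrite mulnCA mulnn; lia.
move=> s x V a sx; rewrite run_tokens_encode.
apply: (@run_compile Z (symbol s) x _ 0 V a [::]) => //.
- by move=> k; rewrite /is1 symbol_true.
Qed.

(** * Memorising circuits *)

(** Listing a tree in postorder meets [circuit_wf] by construction: every vertex except the root is
    used by its parent in the tree, and the two operands of a gate are distinct vertices. *)
Inductive form := FIn of nat | FNot of form | FAnd of form & form | FOr of form & form.

Fixpoint fsize (f : form) : nat :=
  match f with FIn _ => 1 | FNot f => (fsize f).+1 | FAnd f g | FOr f g => (fsize f + fsize g).+1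
    end.

Fixpoint feval (x : seq bool) (f : form) : bool :=
  match f with
  | FIn k => nth false x k
  | FNot f => ~~ feval x f
  | FAnd f g => feval x f && feval x g
  | FOr f g => feval x f || feval x g
  end.

Fixpoint fok (n : nat) (f : form) : bool :=
  match f with FIn k => k < n | FNot f => fok n f | FAnd f g | FOr f g => fok n f && fok n g end.

Fixpoint flat (i : nat) (f : form) : seq vertex :=
  match f with
  | FIn k => [:: VIn k]
  | FNot f => rcons (flat i f) (VNot (i + fsize f).-1)
  | FAnd f g => rcons (flat i f ++ flat (i + fsize f) g)
                  (VAnd (i + fsize f).-1 (i + fsize f + fsize g).-1)
  | FOr f g => rcons (flat i f ++ flat (i + fsize f) g)
                 (VOr (i + fsize f).-1 (i + fsize f + fsize g).-1)
  end.

Lemma fsize_gt0 f : 0 < fsize f.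
Proof. by case: f. Qed.

Lemma size_flat i f : size (flat i f) = fsize f.
Proof.
by elim: f i => //= [f IH|f IHf g IHg|f IHf g IHg] i; rewrite size_rcons ?size_cat ?IH ?IHf ?IHg.
Qed.

Lemma flat_ok n i f j : fok n f -> j < fsize f -> vertex_ok n (i + j) (nth (VIn 0) (flat i f) j).
Proof.
elim: f i j => [k|f IH|f IHf g IHg|f IHf g IHg] i j /=.
- by case: j.
- move=> ok; rewrite nth_rcons size_flat ltnS leq_eqVlt => /orP[/eqP ->|lj].
    by rewrite ltnn eqxx /=; have := fsize_gt0 f; lia.
  by rewrite lj IH.
- move=> /andP[okf okg]; rewrite nth_rcons size_cat !size_flat ltnS leq_eqVlt => /orP[/eqP ->|lj].
    by rewrite ltnn eqxx /=; have := fsize_gt0 f; have := fsize_gt0 g; lia.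
  rewrite lj nth_cat size_flat; case: ltnP => lf; first exact: IHf.
  by have := IHg (i + fsize f) (j - fsize f) okg; rewrite -addnA subnKC //; apply; lia.
- move=> /andP[okf okg]; rewrite nth_rcons size_cat !size_flat ltnS leq_eqVlt => /orP[/eqP ->|lj].
    by rewrite ltnn eqxx /=; have := fsize_gt0 f; have := fsize_gt0 g; lia.
  rewrite lj nth_cat size_flat; case: ltnP => lf; first exact: IHf.
  by have := IHg (i + fsize f) (j - fsize f) okg; rewrite -addnA subnKC //; apply; lia.
Qed.

Lemma flat_used i f j : j.+1 < fsize f -> has (fun v => i + j \in parents v) (flat i f).
Proof.
elim: f i j => [k|f IH|f IHf g IHg|f IHf g IHg] i j //=; rewrite ltnS => lj.
- rewrite has_rcons /= inE; have [e|ne] := eqVneq j.+1 (fsize f).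
    by apply/orP; left; apply/eqP; lia.
  by rewrite IH ?orbT //; lia.
- rewrite has_rcons has_cat /= !inE; have [lf|lf] := ltnP j.+1 (fsize f).
    by rewrite IHf // ?orbT.
  have [e|ne] := eqVneq j.+1 (fsize f); first by apply/orP; left; apply/orP; left; apply/eqP; lia.
  have [e|ne'] := eqVneq j.+1 (fsize f + fsize g).
    by apply/orP; left; apply/orP; right; apply/eqP; lia.
  have := IHg (i + fsize f) (j - fsize f); rewrite -addnA subnKC; last lia.
  by move=> ->; rewrite ?orbT //; lia.
- rewrite has_rcons has_cat /= !inE; have [lf|lf] := ltnP j.+1 (fsize f).
    by rewrite IHf // ?orbT.
  have [e|ne] := eqVneq j.+1 (fsize f); first by apply/orP; left; apply/orP; left; apply/eqP; lia.
  have [e|ne'] := eqVneq j.+1 (fsize f + fsize g).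
    by apply/orP; left; apply/orP; right; apply/eqP; lia.
  have := IHg (i + fsize f) (j - fsize f); rewrite -addnA subnKC; last lia.
  by move=> ->; rewrite ?orbT //; lia.
Qed.

Section Eval.
Variable x : seq bool.
Notation ev := (foldl (fun vals v => rcons vals (eval_vertex x vals v))).

Lemma nth_last_cat (s u : seq bool) : 0 < size u -> nth false (s ++ u) (size s + size u).-1 = last
  false u.
Proof.
move=> u0; rewrite nth_cat ifF; last by lia.
by rewrite -nth_last; congr nth; lia.
Qed.

Lemma ev_flat vals f : exists u,
  [/\ ev vals (flat (size vals) f) = vals ++ u, size u = fsize f & last false u = feval x f].
Proof.
elim: f vals => [k|f IH|f IHf g IHg|f IHf g IHg] vals /=.
- by exists [:: nth false x k]; rewrite cats1.
- have [u [e su lu]] := IH vals.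
  exists (rcons u (~~ feval x f)); rewrite foldl_rcons e size_rcons su last_rcons; split=> //.
  by rewrite /= -su nth_last_cat ?su ?fsize_gt0 // lu rcons_cat.
- have [u [e su lu]] := IHf vals; have [v [e' sv lv]] := IHg (vals ++ u).
  have u0 : 0 < size u by rewrite su fsize_gt0.
  have v0 : 0 < size v by rewrite sv fsize_gt0.
  exists (rcons (u ++ v) (feval x f && feval x g)).
  split; [|by rewrite size_rcons size_cat su sv|by rewrite last_rcons].
  rewrite foldl_rcons foldl_cat e -su -size_cat e' -sv /= nth_last_cat // lv -lu.
  rewrite size_cat nth_cat size_cat ifT; last by lia.
  by rewrite nth_last_cat // -rcons_cat catA.
- have [u [e su lu]] := IHf vals; have [v [e' sv lv]] := IHg (vals ++ u).
  have u0 : 0 < size u by rewrite su fsize_gt0.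
  have v0 : 0 < size v by rewrite sv fsize_gt0.
  exists (rcons (u ++ v) (feval x f || feval x g)).
  split; [|by rewrite size_rcons size_cat su sv|by rewrite last_rcons].
  rewrite foldl_rcons foldl_cat e -su -size_cat e' -sv /= nth_last_cat // lv -lu.
  rewrite size_cat nth_cat size_cat ifT; last by lia.
  by rewrite nth_last_cat // -rcons_cat catA.
Qed.

End Eval.

Lemma circuit_of_form n f x : fok n f -> size x = n ->
  circuit_eval (Circuit n (flat 0 f)) x = Some (feval x f).
Proof.
move=> ok sx; rewrite /circuit_eval ifT.
  have [u [e _ <-]] := ev_flat x [::] f; congr Some.
  by rewrite /circuit_vals e.
rewrite /= sx eqxx andbT /circuit_wf /= size_flat fsize_gt0 /=; apply/andP; split.
  by apply/allP => j; rewrite mem_iota add0n => lj; apply: (@flat_ok n 0).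
by apply/allP => j; rewrite mem_iota add0n => lj; apply: (@flat_used 0); lia.
Qed.

(** Circuits have no constant gates, so constants are made from input 0; this is where 0 < n
    enters. *)
Definition Ftrue := FOr (FIn 0) (FNot (FIn 0)).
Definition Ffalse := FAnd (FIn 0) (FNot (FIn 0)).

Definition Feq (x : seq bool) : form :=
  foldr (fun k g => FAnd (if nth false x k then FIn k else FNot (FIn k)) g) Ftrue (iota 0 (size x)).

Definition Fmem (s : seq (seq bool)) : form := foldr (fun x g => FOr (Feq x) g) Ffalse s.

Lemma fsize_Feq x : fsize (Feq x) <= 4 + 3 * size x.
Proof.
rewrite /Feq -{2}(size_iota 0 (size x)); elim: (iota _ _) => //= k s IH.
by case: nth => /=; lia.
Qed.

Lemma fok_Feq n x : 0 < n -> size x <= n -> fok n (Feq x).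
Proof.
move=> n0 sx; rewrite /Feq.
have : all (fun k => k < n) (iota 0 (size x)) by apply/allP => k; rewrite mem_iota; lia.
by elim: (iota _ _) => /= [|k s IH /andP[kn /IH ->]]; rewrite ?n0 //; case: nth => /=; rewrite kn.
Qed.

Lemma feval_Feq x y : size x = size y -> feval y (Feq x) = (x == y).
Proof.
move=> e; have -> : (x == y) = all (fun k => nth false x k == nth false y k) (iota 0 (size x)).
  apply/eqP/allP => [->|h] //; apply: (eq_from_nth (x0 := false)) => // i li.
  by apply/eqP/h; rewrite mem_iota.
rewrite /Feq; elim: (iota _ _) => /= [|k s ->]; first by case: nth.
by congr (_ && _); case: (nth false x k) => /=; case: (nth false y k).
Qed.

Lemma fsize_Fmem n s : all (fun x => size x == n) s -> fsize (Fmem s) <= 4 + size s * (5 + 3 * n).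
Proof.
elim: s => //= x s IH /andP[/eqP sx /IH]; have := fsize_Feq x; rewrite sx mulSn; lia.
Qed.

Lemma fok_Fmem n s : 0 < n -> all (fun x => size x == n) s -> fok n (Fmem s).
Proof.
move=> n0; elim: s => /= [|x s IH /andP[/eqP sx /IH ->]]; first by rewrite n0.
by rewrite fok_Feq ?sx.
Qed.

Lemma feval_Fmem n s y : all (fun x => size x == n) s -> size y = n -> feval y (Fmem s) = (y \in s).
Proof.
move=> al sy; elim: s al => /= [|x s IH /andP[/eqP sx /IH ->]]; first by case: nth.
by rewrite feval_Feq ?sx // in_cons eq_sym.
Qed.

Lemma clog2_leq n : clog2 n <= n.
Proof. by apply: up_log_min => //; apply: ltnW; exact: ltn_expl. Qed.

Lemma Lenc_leq s s' n : s <= s' -> Lenc s n <= 2 * n + 2 + s' * (3 + 2 * s' + n).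
Proof.
move=> ss; rewrite /Lenc; have cn := clog2_leq n; have cs := clog2_leq s.
by apply: leq_add; [lia | apply: leq_mul => //; rewrite -addnA leq_add2l geq_max; lia].
Qed.

Lemma memorizing_circuit n m (xs : {ffun 'I_m -> n.-tuple bool}) (f : n.-tuple bool -> bool) :
  0 < n -> exists C : circuit, consistent (phi := Cinterp) xs f C /\
    plen (i := Cinterp) C <= 2 * n + 2 + (4 + m * (5 + 3 * n)) *
      (3 + 2 * (4 + m * (5 + 3 * n)) + n).
Proof.
move=> n0.
(* The circuit accepts exactly the sample points with label 1; it is total, and right on those with
   label 0 because they are not in the list. *)
pose s := [seq (tval (xs j)) | j <- enum 'I_m & f (xs j)].
have al : all (fun x => size x == n) s by apply/allP => _ /mapP[j _ ->]; rewrite size_tuple.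
exists (Circuit n (flat 0 (Fmem s))); split; last first.
  apply: Lenc_leq; rewrite /= size_flat; apply: leq_trans (fsize_Fmem al) _.
  rewrite leq_add2l leq_mul2r; apply/orP; right.
  by rewrite size_map size_filter; apply: leq_trans (count_size _ _) _; rewrite size_enum_ord.
split=> [x|j] /=; rewrite circuit_of_form ?fok_Fmem ?size_tuple //.
rewrite (feval_Fmem al) ?size_tuple //; congr Some.
apply/mapP/idP => [[j']|fj]; last by exists j => //; rewrite mem_filter fj mem_enum.
by rewrite mem_filter => /andP[fj' _] /val_inj ->.
Qed.

(** * Hard tables *)

Definition easy (T : seq bool) : Prop := exists w, verify T w.

Lemma bits_pow2 r : bits (2 ^ r) = rcons (nseq r false) true.
Proof.
have double n : 0 < n -> bits (2 * n) = false :: bits n.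
  elim: n => // n IH _; case: n IH => [|n] IH //.
  have -> : 2 * n.+2 = (2 * n.+1).+2 by lia.
  rewrite -[bits _.+2]/(incb (incb (bits (2 * n.+1)))) IH //.
by elim: r => // r IH; rewrite expnS double ?expn_gt0 // IH.
Qed.

Lemma pow2b_bits r : pow2b (bits (2 ^ r)).
Proof.
by rewrite bits_pow2 /pow2b size_rcons size_nseq; elim: r => //= r /eqP [->].
Qed.

Lemma pow2b_inv N : pow2b (bits N) -> exists r, N = 2 ^ r.
Proof.
have pow2 s : pow2b s -> s = rcons (nseq (index true s) false) true.
  rewrite /pow2b; elim: s => [|[] s IH] //=; first by case: s {IH}.
  by rewrite eqSS => /IH {1}->.
have val k : bval (rcons (nseq k false) true) = 2 ^ k.
  by elim: k => //= k ->; rewrite expnS.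
by move=> /pow2 e; exists (index true (bits N)); rewrite -{1}(bval_bits N) {1}e val.
Qed.

Lemma leq_expl m n e : m <= n -> m ^ e <= n ^ e.
Proof. by case: e => // e mn; rewrite leq_exp2r. Qed.

(** The claim is 2(2 3^8)^M < (2^14)^M. Since 2 3^8 / 2^14 <= 5/6, it suffices that 2 (5/6)^M < 1,
    which holds from M = 4 on; this is the origin of 5 <= r below. *)
Lemma count_numeric M : 4 <= M -> 2 ^ M.+1 * 3 ^ (8 * M) < 2 ^ (8 * M) * 2 ^ (6 * M).
Proof.
move=> M4.
have base : 2 * 5 ^ M < 6 ^ M.
  rewrite -(subnK M4); elim: (M - 4) => [|k IH]; first by vm_compute.
  by rewrite addSn !expnS; move: IH; set a := 5 ^ _; set b := 6 ^ _; lia.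
have step : (2 * 3 ^ 8) ^ M * 6 ^ M <= (2 ^ 14) ^ M * 5 ^ M.
  have pw a b c d : a * b <= c * d -> a ^ M * b ^ M <= c ^ M * d ^ M.
    by move=> le; rewrite -!expnMn leq_expl.
  by apply: pw; lia.
have -> : 2 ^ M.+1 * 3 ^ (8 * M) = 2 * (2 * 3 ^ 8) ^ M by rewrite expnS expnMn expnM mulnA.
have -> : 2 ^ (8 * M) * 2 ^ (6 * M) = (2 ^ 14) ^ M by rewrite -expnD -expnM; congr expn; lia.
have q0 : 0 < (2 ^ 14) ^ M by rewrite -expnM expn_gt0.
rewrite ltnNge; apply/negP => h.
move: base step q0 h; set Q := (2 ^ 14) ^ M; set P := (2 * 3 ^ 8) ^ M; set a := 5 ^ M;
  set b := 6 ^ M.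
move=> ab Pb q0 h.
have h1 : Q * b <= 2 * P * b by rewrite leq_mul2r h orbT.
have h2 : Q * (2 * a) < Q * b by rewrite ltn_mul2l q0 ab.
by rewrite -mulnA in h1; rewrite mulnCA in h2; lia.
Qed.

(* Averaging 2^(number of agreements) over all tables bounds the number of easy ones. *)
Lemma sum_agree N (o : 'I_N -> bool) :
  \sum_(t : {ffun 'I_N -> bool}) 2 ^ (\sum_j (o j == t j)) = 3 ^ N.
Proof.
under eq_bigr => t _ do rewrite expn_sum.
rewrite -(bigA_distr_bigA (fun j b => 2 ^ (o j == b))) /=.
rewrite (eq_bigr (fun _ => 3)); first by rewrite prod_nat_const card_ord.
by move=> j _; rewrite big_bool; case: (o j).
Qed.

(** If all 2^(8M) tables were easy, each would contribute at least 2^(6M) to the sum of 2^[agr] over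
    all tables and all programs of length at most M. By [sum_agree] that sum is below 2^(M+1)
    3^(8M). The weight 2 per agreement replaces a Chernoff bound. *)
Lemma hard_exists r : 5 <= r -> exists T, size T = 2 ^ r /\ ~ easy T.
Proof.
move=> r5; set N := 2 ^ r.
pose M := 2 ^ (r - 3).
have NM : N = 8 * M by rewrite /N /M -(expnD 2 3) subnKC //; lia.
have M4 : 4 <= M by rewrite /M -[4]/(2 ^ 2) leq_exp2l //; lia.
apply: contrapT => none.
pose tbl (t : {ffun 'I_N -> bool}) := [seq t j | j <- enum 'I_N].
have st t : size (tbl t) = N by rewrite size_map size_enum_ord.
have nt t (j : 'I_N) : nth false (tbl t) j = t j.
  by rewrite (nth_map j) ?size_enum_ord // nth_ord_enum.
pose agr (w : seq bool) (t : {ffun 'I_N -> bool}) := \sum_(j < N) (output w N j == t j).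
have agrE w t : agr w t + mismatch (tbl t) w N = N.
  rewrite /agr /mismatch st big_mkord -big_split /= -[RHS]card_ord -sum1_card.
  by apply: eq_bigr => j _; rewrite nt; case: eqP.
(* With N = 8M, shortness means |w| <= M, and at most N/4 = 2M mismatches leave 6M agreements. *)
have ez t : exists2 w, size w <= M & 6 * M <= agr w t.
  have [w] : easy (tbl t) by apply: contrapT => h; apply: none; exists (tbl t).
  rewrite /verify /short st pow2b_bits /= => /andP[sh ms]; exists w; last first.
    by have := agrE w t; lia.
  by move: sh; case: (w) => [|? ?] /=; lia.
have : 2 ^ (8 * M) * 2 ^ (6 * M) <=
   \sum_(t : {ffun 'I_N -> bool}) \sum_(k < M.+1) \sum_(w : k.-tuple bool) 2 ^ agr w t.
  have -> : 2 ^ (8 * M) = #|{ffun 'I_N -> bool}| by rewrite card_ffun card_bool card_ord NM.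
  rewrite -sum_nat_const; apply: leq_sum => t _.
  have [w sw le] := ez t; rewrite -ltnS in sw.
  rewrite (bigD1 (Ordinal sw)) //= (bigD1 (in_tuple w)) //= -addnA.
  by apply: leq_trans (leq_addr _ _); rewrite leq_exp2l.
rewrite exchange_big /=.
under eq_bigr => k _ do rewrite exchange_big /=.
under eq_bigr => k _ do under eq_bigr => w _ do rewrite sum_agree.
under eq_bigr => k _ do rewrite sum_nat_const card_tuple card_bool.
rewrite -big_distrl /= NM => le.
have geo : \sum_(k < M.+1) 2 ^ k < 2 ^ M.+1.
  elim: M.+1 => [|k IH]; first by rewrite big_ord0.
  by rewrite big_ord_recr /= expnS mul2n -addnn ltn_add2r.
have := count_numeric M4; rewrite ltnNge => /negP; apply.
by apply: leq_trans le _; rewrite leq_mul2r (ltnW geo) orbT.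
Qed.

(** * The first hard table when P = NP *)

(** [inP] and [inNP] use one parameter both as factor and as exponent; this absorbs any polynomial
    into that form. Powers of n + 1 also cover n = 0. *)
Lemma poly_bound a d : exists k0, forall k n, k0 <= k -> a * n.+1 ^ d <= k * n ^ k + k.
Proof.
(* For n > 0, n + 1 <= 2n costs the factor 2^d; the summand d makes the exponent large enough. *)
exists (a * 2 ^ d + d) => k n lek.
have le1 : a * 2 ^ d <= k by lia.
case: n => [|n].
  rewrite exp1n muln1; apply: leq_trans (leq_addl _ _).
  by apply: leq_trans le1; rewrite leq_pmulr ?expn_gt0.
apply: leq_trans (leq_addr _ _).
apply: (@leq_trans (a * 2 ^ d * n.+1 ^ d)).
  by rewrite -mulnA -expnMn leq_mul2l; apply/orP; right; apply: leq_expl; lia.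
by apply: leq_mul => //; apply: leq_pexp2l => //; lia.
Qed.

Lemma program_machine (p : program) (M : TM) : tm_ni M = 1 ->
  exists M' : TM, [/\ tm_ni M' = 2,
    forall X Y h b, halts X Y p store0 h b -> tm_out M' (inp2 X Y) b.+1 = Some h &
    forall X Y b s b1 h t, runs X Y p store0 (inl b) s b1 -> hY s = 0 ->
      tm_out M (inp1 Y) t = Some h -> tm_out M' (inp2 X Y) (b1 + t).+2 = Some (b == h)].
Proof.
case: M => Q ni k st ac rj d /= e; subst ni.
exists (build p st ac rj d); split=> //.
  by move=> X Y h b [s r]; exact: build_halt r.
by move=> X Y b s b1 h t r hs eM; exact: build_call r hs eM.
Qed.

(** A dummy callee for programs that always halt by themselves. *)
Definition idle : TM :=
  @MkTM 1 1 0 ord0 ord0 ord0 (fun q _ _ => (q, [ffun=> None], [ffun=> MStay], [ffun=> MStay])).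

Lemma short_size T w : short T w -> size w <= (size T).+1.
Proof. by rewrite /short; case: w => [|? ?] /=; lia. Qed.

Lemma inNP_easy : inNP easy.
Proof.
have [M [ni halt_out _]] := @program_machine verify_prog idle erefl.
(* A short w has |w| + |T| + 3 <= 4(|T| + 1), so [verify_prog] takes at most 1600(|T| + 1)^2 steps;
   one more writes the marks. *)
have [k0 kP] := poly_bound 1700 2.
exists M, k0; split=> // T; set B := _ + _.
have BT : 1700 * (size T).+1 ^ 2 <= B by apply: kP.
have run w := halt_out _ _ _ _ (verify_prog_run T w).
split=> [[w vw]|[w [_ o]]]; last first.
  by exists w; rewrite (tm_out_inj (run w) o).
have sw : size w <= (size T).+1 by apply: short_size; case/andP: vw.
have e2 : (size T).+1 <= (size T).+1 ^ 2 by rewrite -mulnn leq_pmulr.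
exists w; split; first by lia.
rewrite -vw; apply: tm_out_mono (run w) _; apply: leq_trans BT.
have : (size w + size T + 3) ^ 2 <= (4 * (size T).+1) ^ 2 by apply: leq_expl; lia.
by rewrite expnMn; lia.
Qed.

(* With T' = T or T' < T as the witness, a single call of the machine for [easy] on T' suffices. *)
Definition not_first (T : seq bool) : Prop :=
  easy T \/ exists T', lexlt T' T /\ ~ easy T'.

Section Collapse.
Hypothesis NP_P : forall L, inNP L -> inP L.

(** The running time is bounded in terms of the witness, but an accepted witness has the length of
    T, which makes the bound a polynomial in |T|. *)
Lemma inNP_not_first : inNP not_first.
Proof.
have [M1 [k1 [ni1 dec1]]] := NP_P inNP_easy.
have [M [ni halt_out call_out]] := @program_machine lex_prog M1 ni1.
have [k0 kP] := poly_bound (62 + 2 * k1) k1.+1.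
exists M, k0; split=> // T; set B := _ + _.
have BT : (62 + 2 * k1) * (size T).+1 ^ k1.+1 <= B by apply: kP.
have run w : exists o, [/\ o = true <-> (T = w /\ easy w \/ lexlt w T /\ ~ easy w) &
    tm_out M (inp2 T w) (20 * (size w + 3) + (k1 * size w ^ k1 + k1)).+2 = Some o].
  have [b [eb hb]] := dec1 w.
  have := lex_prog_run T w; have [e|ne] := eqVneq T w => [[s r hs]|].
    exists (true == b); split; last exact: call_out r hs eb.
    rewrite -{}e in hb *; split=> [/eqP be|[[_ /hb ->]|[lt]]] //.
      by left; split=> //; apply/hb.
    by rewrite lexlt_mval // ltnn in lt.
  case: ifP => [lt [s r hs]|lt [s r]].
    exists (false == b); split; last exact: call_out r hs eb.
    split=> [/eqP be|[[/eqP]|[_ nb]]]; first by right; split=> // /hb; rewrite -be.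
      by rewrite (negbTE ne).
    by apply/eqP/esym; apply: contra_notF nb => bt; apply/hb.
  exists false; split; last first.
    by apply: tm_out_mono (halt_out _ _ _ _ (ex_intro _ s r)) _; lia.
  by split=> // -[[/eqP]|[]]; rewrite ?lt ?(negbTE ne).
have bound (w : seq bool) : size w = size T ->
    [/\ size w <= B & (20 * (size w + 3) + (k1 * size w ^ k1 + k1)).+2 <= B].
  move=> sw; rewrite sw; have : (size T).+1 ^ k1.+1 <= B.
    by apply: leq_trans BT; rewrite leq_pmull.
  have p1 : (size T).+1 <= (size T).+1 ^ k1.+1 by rewrite expnS leq_pmulr ?expn_gt0.
  have p2 : size T ^ k1 <= (size T).+1 ^ k1.+1.
    by apply: leq_trans (leq_pexp2l _ (leqnSn k1)) => //; exact: leq_expl.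
  move=> ?; split; first by lia.
  have : k1 * size T ^ k1 <= k1 * (size T).+1 ^ k1.+1 by rewrite leq_mul2l p2 orbT.
  have : k1 * 1 <= k1 * (size T).+1 ^ k1.+1 by rewrite leq_mul2l expn_gt0 orbT.
  by move=> h1 h2; apply: leq_trans BT; lia.
split=> [nf|[w [_ o]]].
  have [w [sw ok]] : exists w, size w = size T /\ (T = w /\ easy w \/ lexlt w T /\ ~ easy w).
    case: nf => [eT|[T' [lt nT']]]; first by exists T; split=> //; left.
    by exists T'; split; [case/and3P: lt => /eqP | right].
  have [o [oP ro]] := run w; have [b1 b2] := bound w sw.
  by exists w; split=> //; move: ro; move/oP: ok => -> /tm_out_mono; apply.
have [o' [oP ro]] := run w; have e := tm_out_inj ro o.
by case/oP: e => [[-> ew]|[lt nw]]; [left | right; exists w].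
Qed.

Lemma first_exists r : 5 <= r -> exists T, size T = 2 ^ r /\ ~ not_first T.
Proof.
move=> r5; have [T0 [s0 h0]] := hard_exists r5.
pose Q v := `[< exists T, [/\ size T = 2 ^ r, ~ easy T & mval T = v] >].
have exQ : exists v, Q v by exists (mval T0); apply/asboolP; exists T0.
case: (ex_minnP exQ) => v /asboolP[T [sT hT <-]] vmin.
exists T; split=> // -[//|[T' [lt hT']]].
have sT' : size T' = size T by case/and3P: lt => /eqP.
move: lt; rewrite lexlt_mval // ltnNge vmin //.
by apply/asboolP; exists T'; rewrite sT' sT.
Qed.

Lemma first_uniq T T' : size T = size T' -> ~ not_first T -> ~ not_first T' -> T = T'.
Proof.
move=> e n n'; apply: mval_inj => //; apply/eqP; rewrite eqn_leq.
apply/andP; split; rewrite leqNgt; apply/negP => lt.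
  apply: n; right; exists T'; split; first by rewrite (lexlt_mval (esym e)).
  by move=> ez; apply: n'; left.
apply: n'; right; exists T; split; first by rewrite (lexlt_mval e).
by move=> ez; apply: n; left.
Qed.

(** By the convention in [verify], the empty program makes a table of any other length easy. *)
Lemma first_size T : ~ not_first T -> exists r, size T = 2 ^ r.
Proof.
move=> n; apply: pow2b_inv; apply: contrapT => np; apply: n; left.
by exists [::]; rewrite /verify /short /=; apply/andP; split; [lia | apply/implyP].
Qed.

(* An index x of the table T of length N = 2^r satisfies N <= bval x < 2N, which determines N. *)
Lemma hard_language e : exists L, inP L /\
  forall x r T j, size T = 2 ^ r -> ~ not_first T -> j < 2 ^ r -> bval x = 2 ^ r + j ->
    2 ^ r <= (size x).+1 ^ e -> (L x <-> nth false T j).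
Proof.
have [M2 [k2 [ni2 dec2]]] := NP_P inNP_not_first.
have [M [ni halt_out call_out]] := @program_machine index_prog M2 ni2.
(* For |T| <= (|x| + 1)^e this covers both the quadratic time of [index_prog] and the time |T|^k2 of
   the call. *)
pose d := e * 2 + e * k2 + 2.
have [k kP] := poly_bound (2500 + 2 * k2 + 2) d.
pose B (x : seq bool) := k * size x ^ k + k.
pose L (x : seq bool) := exists w : seq bool, size w <= B x /\ tm_out M (inp2 x w) (B x) = Some
  true.
exists L; split; first by apply: NP_P; exists M, k.
move=> x r T j sT fT jr vx rx.
have BT : (2500 + 2 * k2 + 2) * (size x).+1 ^ d <= B x by apply: kP.
have powx c c' : c <= c' -> (size x).+1 ^ c <= (size x).+1 ^ c' by apply: leq_pexp2l.
split=> [[w [_ o]]|Tj].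
  have := index_prog_run x w; case: ifP => [sel [s r1 hs]|_ [b /halt_out o']]; last first.
    by have := tm_out_inj o o'.
  have [b [eb hb]] := dec2 w.
  have fb : false = b by apply/eqP; exact: (tm_out_inj (call_out _ _ _ _ _ _ _ r1 hs eb) o).
  have fw : ~ not_first w by move/hb; rewrite -fb.
  have [r' sw] := first_size fw.
  case/andP: sel; rewrite vx sw => le.
  have [lt|ge] := ltnP (2 ^ r + j - 2 ^ r') (2 ^ r'); last by rewrite nth_default // sw.
  have rr : r' = r.
    apply/eqP; rewrite eqn_leq; apply/andP; split; rewrite -ltnS -(ltn_exp2l (m := 2)) // expnS;
      lia.
  by rewrite rr in sw le *; rewrite (first_uniq _ fw fT) ?sw ?sT // addKn.
have sel : selects x T by rewrite /selects sT vx leq_addr addKn.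
have := index_prog_run x T; rewrite sel => -[s r1 hs].
have [b [eb hb]] := dec2 T.
have bf : b = false by apply: contra_notF fT => bt; apply/hb.
have := call_out _ _ _ _ _ _ _ r1 hs eb; rewrite bf eqxx => o.
set S := (size x).+1 in BT powx rx.
have S1 : 1 <= S ^ d by rewrite expn_gt0.
have Te : size T <= S ^ e by rewrite sT.
have SeB c : c <= d -> S ^ c <= B x.
  by move=> cd; apply: leq_trans (leq_trans (powx c d cd) _) BT; rewrite leq_pmull.
exists T; split; first by apply: leq_trans Te (SeB _ _); rewrite /d; lia.
apply: tm_out_mono o _; apply: leq_trans BT.
have q1 : (size x + size T + 3) ^ 2 <= 25 * S ^ d.
  apply: (@leq_trans ((5 * S ^ (e + 1)) ^ 2)).
    apply: leq_expl; rewrite expnD expn1.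
    have : S <= S ^ e * S by rewrite leq_pmull ?expn_gt0.
    have : S ^ e <= S ^ e * S by rewrite leq_pmulr.
    by rewrite {1 3}/S; lia.
  by rewrite expnMn -expnM leq_mul2l powx //= /d; lia.
have q2 : size T ^ k2 <= S ^ d.
  apply: (@leq_trans ((S ^ e) ^ k2)); first exact: leq_expl.
  by rewrite -expnM powx // /d; lia.
have q3 : k2 * size T ^ k2 <= k2 * S ^ d by rewrite leq_mul2l q2 orbT.
have q4 : k2 * 1 <= k2 * S ^ d by rewrite leq_mul2l S1 orbT.
lia.
Qed.

End Collapse.

(** * Sample complexity *)

Import Order.TTheory GRing.Theory Num.Theory.
Local Open Scope ring_scope.

Section Learn.
Variable R : realType.

Lemma mdl_choice_exists (phi : interp) n m (xs : {ffun 'I_m -> n.-tuple bool}) f (h : prog phi) :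
  consistent xs f h -> exists h' : prog phi, mdl_choice xs f h' /\ (plen h' <= plen h)%N.
Proof.
move=> ch.
pose Q := fun k => `[< exists h' : prog phi, consistent xs f h' /\ plen h' = k >].
have exQ : exists k, Q k by exists (plen h); apply/asboolP; exists h.
case: (ex_minnP exQ) => k /asboolP[h' [ch' <-]] kmin.
exists h'; split; last by apply: kmin; apply/asboolP; exists h.
by split=> // h2 ch2; apply: kmin; apply/asboolP; exists h2.
Qed.

Lemma prob_data_prod n m (P : {ffun n.-tuple bool -> R}) (Q : n.-tuple bool -> bool) :
  \sum_(xs : {ffun 'I_m -> n.-tuple bool}) (\prod_j P (xs j)) * (\prod_j (Q (xs j))%:R) =
  (\sum_(x | Q x) P x) ^+ m.
Proof.
under eq_bigr => xs _ do rewrite -big_split /=.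
rewrite -(bigA_distr_bigA (fun _ x => P x * (Q x)%:R)) /= prodr_const card_ord.
congr (_ ^+ _); rewrite [RHS]big_mkcond; apply: eq_bigr => x _.
by case: (Q x); rewrite ?mulr1 ?mulr0.
Qed.

Lemma acc_ge0 n (P : {ffun n.-tuple bool -> R}) f g : is_dist P -> 0 <= acc P f g.
Proof. by move=> [P0 _]; apply: sumr_ge0. Qed.

(** Occam bound: the chosen program is no longer than h, so a failure means that one of the fewer
    than 2^(l+1) strings of length at most l is inaccurate and yet agrees with the whole sample,
    which for each of them has probability at most (1 - eps)^m. *)
Lemma mdl_pac_occam (phi : seq bool -> seq bool -> option bool) n
    (f : n.-tuple bool -> bool) (P : {ffun n.-tuple bool -> R}) (eps del : R) (h : seq bool) m :
  is_dist P -> 0 <= eps <= 1 -> computes (phi := str_interp phi) h f ->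
  2 ^+ (size h).+1 * (1 - eps) ^+ m <= del -> mdl_pac (str_interp phi) f P eps del m.
Proof.
move=> dP epsP hf hm m' mm' A HA.
set l := size h in hm *.
have [P0 P1] := dP; have /andP[eps0 eps1] := epsP.
(* Despite its name this is the accuracy of g. *)
pose err (g : seq bool) := acc P f (out_fun (phi := str_interp phi) (n := n) g).
pose bad (g : seq bool) := err g < 1 - eps.
pose agree (g : seq bool) (x : n.-tuple bool) := out_fun (phi := str_interp phi) g x == f x.
pose E (xs : {ffun 'I_m' -> n.-tuple bool}) :=
  (exists h0 : prog (str_interp phi), mdl_choice xs f h0) /\ 1 - eps <= acc P f (out_fun (A xs)).
(* The union bound, stated pointwise for each dataset before taking expectations. *)
have key (xs : {ffun 'I_m' -> n.-tuple bool}) :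
  1 <= (if `[< E xs >] then 1 else 0) +
    \sum_(k < l.+1) \sum_(t : k.-tuple bool) (bad t)%:R * (\prod_j (agree t (xs j))%:R : R).
  have S0 k : 0 <= \sum_(t : k.-tuple bool) (bad t)%:R * (\prod_j (agree t (xs j))%:R : R).
    by apply: sumr_ge0 => t _; apply: mulr_ge0; [|apply: prodr_ge0].
  case: asboolP => [_|nE]; first by rewrite lerDl; apply: sumr_ge0.
  have ch : consistent (phi := str_interp phi) xs f h.
    by split=> [x|j]; rewrite hf.
  have [h0 [mh0 lh0]] := mdl_choice_exists ch.
  have mA := HA xs (ex_intro _ h0 mh0).
  have [cA minA] := mA.
  have lA : (size (A xs) < l.+1)%N by rewrite ltnS; exact: (minA h).
  have bA : bad (A xs).
    by rewrite /bad ltNge; apply/negP => g; apply: nE; split=> //; exists h0.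
  rewrite add0r (bigD1 (Ordinal lA)) //= (bigD1 (in_tuple (A xs))) //= bA mul1r.
  rewrite (eq_bigr (fun _ => 1)); last first.
    move=> j _; rewrite /agree /out_fun; have [_ cj] := cA.
    by have := cj j; rewrite /= => -> /=; rewrite eqxx.
  rewrite big1_eq -addrA lerDl; apply: addr_ge0; last by apply: sumr_ge0 => k _; exact: S0.
  by apply: sumr_ge0 => t _; apply: mulr_ge0; [|apply: prodr_ge0].
have W0 (xs : {ffun 'I_m' -> n.-tuple bool}) : 0 <= \prod_j P (xs j) by apply: prodr_ge0.
have W1 : \sum_(xs : {ffun 'I_m' -> n.-tuple bool}) \prod_j P (xs j) = 1.
  have := prob_data_prod m' P xpredT; rewrite P1 expr1n => e; rewrite -[RHS]e.
  by apply: eq_bigr => xs _; rewrite [X in _ * X]big1 ?mulr1.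
have tot : 1 <= prob_data P E +
    \sum_(k < l.+1) \sum_(t : k.-tuple bool) (bad t)%:R * (err t ^+ m').
  rewrite -[1 in X in X <= _]W1 /prob_data.
  have -> : \sum_(k < l.+1) \sum_(t : k.-tuple bool) (bad t)%:R * (err t ^+ m') =
    \sum_(xs : {ffun 'I_m' -> n.-tuple bool}) (\prod_j P (xs j)) *
      \sum_(k < l.+1) \sum_(t : k.-tuple bool) (bad t)%:R * (\prod_j (agree t (xs j))%:R : R).
    under [RHS]eq_bigr => xs _ do rewrite mulr_sumr.
    rewrite exchange_big /=; apply: eq_bigr => k _.
    under [RHS]eq_bigr => xs _ do rewrite mulr_sumr.
    rewrite exchange_big /=; apply: eq_bigr => t _.
    under [RHS]eq_bigr => xs _ do rewrite mulrCA.
    by rewrite -mulr_sumr prob_data_prod.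
  rewrite -big_split /=; apply: ler_sum => xs _.
  by rewrite -mulrDr -[X in X <= _]mulr1 ler_wpM2l.
have small : \sum_(k < l.+1) \sum_(t : k.-tuple bool) (bad t)%:R * (err t ^+ m') <= del.
  have le1 (k : nat) (t : k.-tuple bool) : (bad t)%:R * (err t ^+ m') <= (1 - eps) ^+ m.
    have e0 : 0 <= err t by exact: acc_ge0.
    have : 0 <= (1 - eps) ^+ m by apply: exprn_ge0; lra.
    case: (boolP (bad t)) => bt /= h0; last by rewrite mul0r.
    rewrite mul1r; apply: (@le_trans _ _ ((1 - eps) ^+ m')).
      by apply: lerXn2r; rewrite ?nnegrE //; [lra | exact: ltW].
    by rewrite -(subnKC mm') exprD ler_piMr //; apply: exprn_ile1; lra.
  apply: le_trans hm.
  have -> : 2 ^+ l.+1 * (1 - eps) ^+ m =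
     \sum_(k < l.+1) \sum_(t : k.-tuple bool) (1 - eps) ^+ m + (1 - eps) ^+ m.
    have -> : 2 ^+ l.+1 = \sum_(k < l.+1) 2 ^+ k + 1 :> R.
      by have := @subrX1 R 2 l.+1; rewrite -[2 - 1]/(1 + 1 - 1) addrK mul1r => <-; rewrite subrK.
    rewrite mulrDl mul1r mulr_suml; congr (_ + _); apply: eq_bigr => k _.
    by rewrite sumr_const card_tuple card_bool -[RHS]mulr_natl natrX.
  rewrite -[X in X <= _]addr0; apply: lerD; last by apply: exprn_ge0; lra.
  by apply: ler_sum => k _; apply: ler_sum => t _; exact: le1.
rewrite -/E; lra.
Qed.

Lemma sample_cplx_le (phi : interp) n (f : n.-tuple bool -> bool) (P : {ffun n.-tuple bool -> R})
    (eps del : R) m :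
  (0 < m)%N -> mdl_pac phi f P eps del m ->
  exists a, [/\ sample_cplx phi f P eps del = Some a, (0 < a)%N & (a <= m)%N].
Proof.
move=> m0 pm; rewrite /sample_cplx; case: pselect => [H|nH]; last first.
  by case: nH; exists m; apply/asboolP.
exists (ex_minn H); case: ex_minnP => a /asboolP[a0 _] amin; split=> //.
by apply: amin; apply/asboolP.
Qed.

(** Failure is certain: on every dataset of size m the choice has length at most L, hence low
    accuracy, and the success probability is 0 < 1 - del. A value a <= m would demand success on
    datasets of size m as well. *)
Lemma sample_cplx_gt (phi : interp) n (f : n.-tuple bool -> bool) (P : {ffun n.-tuple bool -> R})
    (eps del : R) m L :
  del < 1 ->
  (forall xs : {ffun 'I_m -> n.-tuple bool}, exists h : prog phi, consistent xs f h /\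
    (plen h <= L)%N) ->
  (forall h : prog phi, (forall x : n.-tuple bool, run h x <> None) -> (plen h <= L)%N ->
     acc P f (out_fun h) < 1 - eps) ->
  forall a, sample_cplx phi f P eps del = Some a -> (m < a)%N.
Proof.
move=> del1 cons hard a; rewrite /sample_cplx; case: pselect => // H [<-].
case: ex_minnP => {}a /asboolP[_ pac] _; rewrite ltnNge; apply/negP => am.
have chosen (xs : {ffun 'I_m -> n.-tuple bool}) :
    exists h : prog phi, mdl_choice xs f h /\ (plen h <= L)%N.
  have [h [ch lh]] := cons xs; have [h' [mh' lh']] := mdl_choice_exists ch.
  by exists h'; split=> //; exact: leq_trans lh' lh.
have [A HA] := choice chosen.
have := pac m am A (fun xs _ => (HA xs).1).
rewrite /prob_data big1 => [|xs _]; first by lra.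
case: asboolP => [[_]|]; last by rewrite mulr0.
have [[[tot _] _] len] := HA xs.
by have := hard _ tot len; rewrite ltNge => /negP.
Qed.

End Learn.

(** * The lower bound and the conclusion *)

(** The most significant bit of a nonempty [bits] is 1, so its length is forced by its value. *)
Lemma size_bits_le m k : (m < 2 ^ k)%N -> (size (bits m) <= k)%N.
Proof.
case: m => // m lt.
have last_inc s : last true s -> last true (incb s).
  elim: s => [|[] s IH] //=; last by case: s {IH}.
  by move=> /IH; case: s {IH} => [|[]].
have last_bits i : last true (bits i) by elim: i => // i; exact: last_inc.
have low s : s != [::] -> last true s -> (2 ^ (size s).-1 <= bval s)%N.
  elim: s => // b s IH _; case: s IH => [|c s] IH /=; first by move=> ->.
  by move=> h; rewrite expnS; have := IH isT h; rewrite /=; lia.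
have := low (bits m.+1); rewrite bval_bits last_bits => h.
have nz : bits m.+1 != [::] by apply/eqP => e; have := bval_bits m.+1; rewrite e.
have := leq_ltn_trans (h nz isT) lt; rewrite ltn_exp2l //.
by case: (size (bits m.+1)).
Qed.

Lemma bval_nth s t : (forall k, nth false s k = nth false t k) -> bval s = bval t.
Proof.
elim: s t => [|b s IH] t h.
  elim: t h => //= c t IH h; have /= <- := h 0%N.
  by rewrite -IH // => k; have /= <- := h k.+1; rewrite nth_nil.
case: t h => [|c t] h /=; last first.
  by have /= -> := h 0%N; rewrite (IH t) // => k; exact: (h k.+1).
have /= -> := h 0%N; rewrite (IH [::]) // => k.
by have /= -> := h k.+1; rewrite nth_nil.
Qed.

(** With C = (2(e+1))^e and q = n / (2(e+1)) rounded down, n^e <= C 2^(qe) <= 2^(C + qe), and both C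
    and qe are at most n/2. *)
Lemma exp_dominates e : exists n0, forall n, (n0 <= n)%N -> (n ^ e <= 2 ^ n)%N.
Proof.
exists (2 * (2 * e.+1) ^ e)%N => n le.
pose q := (n %/ (2 * e.+1))%N.
have nq : (n <= 2 * e.+1 * 2 ^ q)%N.
  apply: (@leq_trans (2 * e.+1 * q.+1)); last by rewrite leq_mul2l ltn_expl // orbT.
  by rewrite mulnC ltnW // ltn_ceil.
apply: leq_trans (leq_expl e nq) _.
rewrite expnMn -expnM.
apply: (@leq_trans (2 ^ ((2 * e.+1) ^ e) * 2 ^ (q * e))).
  by rewrite leq_mul2r; apply/orP; right; apply: ltnW; exact: ltn_expl.
rewrite -expnD leq_exp2l //.
have : (q * (2 * e.+1) <= n)%N by exact: leq_divM.
have : (q * (2 * e.+1) = 2 * (q * e) + 2 * q)%N by rewrite mulnCA mulnS mulnDr addnC.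
by lia.
Qed.

Definition padded n (s : seq bool) : n.-tuple bool := [tuple nth false s i | i < n].

Lemma nth_padded n s k : (size s <= n)%N -> nth false (padded n s) k = nth false s k.
Proof.
move=> sn; have [kn|nk] := ltnP k n.
  by rewrite -[k]/(val (Ordinal kn)) -tnth_nth tnth_mktuple.
by rewrite !nth_default ?size_tuple //; exact: leq_trans nk.
Qed.

Section Uniform.
Variables (R : realType) (n N : nat) (xt : 'I_N -> n.-tuple bool).
Hypothesis N0 : (0 < N)%N.

(** The push-forward of the uniform distribution on the indices, so that accuracy becomes a count
    over j. *)
Definition unif : {ffun n.-tuple bool -> R} := [ffun x => \sum_(j < N) (xt j == x)%:R / N%:R].

Lemma acc_unif f g : acc unif f g = (\sum_(j < N) (g (xt j) == f (xt j)))%:R / N%:R.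
Proof.
rewrite /acc big_mkcond /= natr_sum mulr_suml.
transitivity (\sum_x \sum_(j < N) ((xt j == x)%:R * (g x == f x)%:R / N%:R : R)).
  apply: eq_bigr => x _; rewrite ffunE; case: ifP => h.
    by apply: eq_bigr => j _; rewrite mulr1.
  by rewrite big1 // => j _; rewrite mulr0 mul0r.
rewrite exchange_big /=; apply: eq_bigr => j _.
rewrite (bigD1 (xt j)) // eqxx mul1r big1 => [|x /= ne]; first exact: addr0.
by rewrite eq_sym (negbTE ne) !mul0r.
Qed.

Lemma unif_dist : is_dist unif.
Proof.
split=> [x|]; first by rewrite ffunE; apply: sumr_ge0 => j _; rewrite divr_ge0.
have := acc_unif xpredT xpredT; rewrite /acc /= => ->.
rewrite (eq_bigr (fun _ => 1%N)) // sum1_card card_ord divff // pnatr_eq0; lia.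
Qed.

End Uniform.

(* A circuit of description length L is simulated by a token program of length 27 (L + n)^2. *)
Lemma circuit_error (R : realType) n r (T : seq bool) (f : n.-tuple bool -> bool) L (C : circuit) :
  size T = (2 ^ r)%N -> ~ easy T -> (r < n)%N ->
  (216 * (L + n) ^ 2 < 2 ^ r)%N ->
  (forall j : 'I_(2 ^ r), f (padded n (bits (2 ^ r + j))) = nth false T j) ->
  (forall x : n.-tuple bool, circuit_eval C x <> None) -> (plen (i := Cinterp) C <= L)%N ->
  acc (unif R (fun j : 'I_(2 ^ r) => padded n (bits (2 ^ r + j)))) f (out_fun (phi := Cinterp) C)
    < 1 - 1 / 4.
Proof.
set N := (2 ^ r)%N => sT hT rn big fT tot lenC.
have N0 : (0 < N)%N by rewrite expn_gt0.
have [wf cn] : circuit_wf C /\ c_n C = n.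
  have := tot (padded n [::]); rewrite /circuit_eval size_tuple.
  by case: ifP => // /andP[-> /eqP ->].
(* Each vertex costs at least three bits, so L bounds the number of vertices and L + n all
   addresses. *)
have [] := @circuit_tokens C (L + n) wf; rewrite ?cn; [|lia|].
  by apply: leq_trans (leq_addr _ _); apply: leq_trans lenC; rewrite /= /Lenc; nia.
move=> w sw wC.
have evalC (x : n.-tuple bool) : out_fun (phi := Cinterp) C x = last false (circuit_vals C x).
  by rewrite /out_fun -[run _ _]/(circuit_eval C x) /circuit_eval wf size_tuple cn eqxx.
have outE (j : 'I_N) : output w N j = out_fun (phi := Cinterp) C (padded n (bits (N + j))).
  rewrite /output [sim _ _ _]/= (wC _ (padded n (bits (N + j)))).
    by rewrite evalC.
  (* N + j has at most r + 1 <= n bits; beyond them the blanks of B and the padding both read as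
     0. *)
  move=> k; rewrite nth_padded // size_bits_le //.
  apply: (@leq_trans (2 ^ r.+1)); last by rewrite leq_exp2l.
  by rewrite expnS; have := ltn_ord j; rewrite /N; lia.
(* As 216 = 8 * 27, w is short; since T is not easy, it is the count of mismatches that must
   fail. *)
have bad : (N < 4 * mismatch T w N)%N.
  rewrite ltnNge; apply/negP => le; apply: hT; exists w.
  rewrite /verify sT le implybT andbT /short sT -/N; lia.
have tally : (\sum_(j < N) (out_fun (phi := Cinterp) C (padded n (bits (N + j))) ==
       f (padded n (bits (N + j)))) + mismatch T w N = N)%N.
  rewrite /mismatch sT big_mkord -big_split /= -[RHS]card_ord -sum1_card.
  by apply: eq_bigr => j _; rewrite -/N outE fT; case: eqP.
rewrite acc_unif ltr_pdivrMr ?ltr0n //.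
set s := (\sum_(j < N) _)%N in tally *.
have h : (4 * s < 3 * N)%N by lia.
have : (4 * s)%:R < (3 * N)%:R :> R by rewrite ltr_nat.
rewrite !natrM; lra.
Qed.

(** A circuit memorising n^3 samples has at most n^5 vertices and description length below n^11.
    Squaring gives n^22, and 216 < 10^3 <= n^3 accounts for the exponent 25. *)
Lemma memory_bound n : (10 <= n)%N ->
  (216 * (2 * n + 2 + (4 + n ^ 3 * (5 + 3 * n)) * (3 + 2 * (4 + n ^ 3 * (5 + 3 * n)) + n) + n) ^ 2
    < n ^ 25)%N.
Proof.
move=> n10.
have pw k : (0 < n ^ k)%N by rewrite expn_gt0; lia.
have up k : (10 * n ^ k <= n ^ k.+1)%N by rewrite expnS leq_mul2r n10 orbT.
have S5 : (4 + n ^ 3 * (5 + 3 * n) <= n ^ 5)%N.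
  have := up 3%N; have := up 4%N; have := pw 3%N.
  have -> : (n ^ 3 * (5 + 3 * n) = 5 * n ^ 3 + 3 * n ^ 4)%N by rewrite [(n ^ 4)%N]expnSr; lia.
  lia.
have L11 : (2 * n + 2 + n ^ 5 * (3 + 2 * n ^ 5 + n) + n <= n ^ 11)%N.
  have -> : (n ^ 5 * (3 + 2 * n ^ 5 + n) = 3 * n ^ 5 + 2 * n ^ 10 + n ^ 6)%N.
    by rewrite (expnD n 5 5) [(n ^ 6)%N]expnSr; lia.
  have := up 1%N; have := up 2%N; have := up 3%N; have := up 4%N; have := up 5%N; have := up 6%N.
  have := up 7%N; have := up 8%N; have := up 9%N; have := up 10%N; rewrite !expn1; lia.
set S := (4 + _)%N in S5 *.
have L : (2 * n + 2 + S * (3 + 2 * S + n) + n <= n ^ 11)%N.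
  apply: leq_trans L11; rewrite !leq_add2r leq_add2l; apply: leq_mul => //; lia.
apply: (@leq_ltn_trans (216 * (n ^ 11) ^ 2)); first by rewrite leq_mul2l leq_expl ?orbT.
rewrite -expnM -[25%N]/(22 + 3)%N expnD mulnC ltn_pmul2l //.
by apply: (@leq_trans (10 ^ 3)) => //; apply: leq_expl.
Qed.

(** Three samples pay for one bit of program length, since 2 (3/4)^3 < 1. *)
Lemma occam_numeric (R : realFieldType) l :
  2 ^+ l.+1 * (1 - 1 / 4) ^+ (3 * l.+2) <= 1 / 2 :> R.
Proof.
have [q0 q1] : 0 <= (1 - 1 / 4) ^+ 3 :> R /\ 2 * (1 - 1 / 4) ^+ 3 <= 1 :> R.
  by split; rewrite !exprS expr0; lra.
rewrite exprM; elim: l => [|l IH].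
  by rewrite !exprS !expr0; lra.
rewrite exprS [X in _ * X]exprS mulrACA; apply: le_trans IH.
by rewrite ler_piMl // mulr_ge0 // exprn_ge0.
Qed.

Theorem theorem6 (R : realType) (U : nat -> seq bool -> seq bool -> option bool) :
  universal_family U ->
  (forall (eps del : R) (c d : nat) (gam : R),
      0 < eps < 1 / 2 -> 0 < del < 1 -> (0 < c)%N -> (0 < d)%N -> 0 < gam ->
      bigO_pow (fun n => gain (str_interp (U c)) Cinterp d eps del n) (1 + gam)) ->
  P_neq_NP.
Proof.
move=> univ small_gain; apply: contrapT => PNP.
have NP_P L : inNP L -> inP L.
  by move=> nL; apply: contrapT => pL; apply: PNP; exists L.
(* 26 because the table length, between n^25 and 2 n^25, is below n^26. *)
have [L [[M [k [ni dec]]] Lfirst]] := hard_language NP_P 26.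
pose g x := `[< L x >].
have [h [n1 Uh]] : exists h n1, forall x, (n1 <= size x)%N -> U k.+1 h x = Some (g x).
  apply: (univ k.+1 k M g k) => // x; have [b [-> bL]] := dec x; congr Some.
  by apply/idP/asboolP => /bL.
pose l := size h; pose m0 := (3 * l.+2)%N.
(* c = k + 1 exceeds the exponent of the machine for L; d = 1 suffices because h has constant
   length; gam = 1 bounds the gain by K n^2. *)
have [K [n2 gainK]] := small_gain (1 / 4) (1 / 2) k.+1 1%N 1
  ltac:(apply/andP; split; lra) ltac:(apply/andP; split; lra) isT isT ltr01.
have [n3 dom] := exp_dominates 26.
(* From n > m0 K on, n^3 / m0 exceeds K n^2. *)
have [n4 n4K] : exists n4, m0%:R * K < n4%:R.
  by exists (Num.bound `|m0%:R * K|); exact: le_lt_trans (ler_norm _) (archi_boundP (normr_ge0 _)).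
have [n [nn1 nn2 nn3 nn4 [nnl n10]]] : exists n,
    [/\ n1 <= n, n2 <= n, n3 <= n, n4 <= n & l <= n /\ 10 <= n]%N.
  by exists (n1 + n2 + n3 + n4 + l + 10)%N; split; lia.
have p25 : (0 < n ^ 25)%N by rewrite expn_gt0; lia.
have [r nN Nn] : exists2 r, (n ^ 25 <= 2 ^ r)%N & (2 ^ r <= 2 * n ^ 25)%N.
  exists (up_log 2 (n ^ 25)); first exact: up_logP.
  have gt1 : (1 < n ^ 25)%N by rewrite -(exp1n 25) ltn_exp2r //; apply: leq_trans n10.
  have lt := up_log_gtn (p := 2) isT gt1.
  have r0 : (0 < up_log 2 (n ^ 25))%N by rewrite up_log_gt0.
  by rewrite -{1}(prednK r0) expnS leq_mul2l ltnW.
set N := (2 ^ r)%N in nN Nn.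
have n26 : (10 * n ^ 25 <= n ^ 26)%N by rewrite [(n ^ 26)%N]expnS leq_mul2r n10 orbT.
(* An index of the table has r + 1 bits and must fit into n. *)
have rn : (r < n)%N.
  have : (n ^ 26 <= 2 ^ n)%N by exact: dom.
  rewrite -(ltn_exp2l r n (isT : 1 < 2)%N) -/N; apply: leq_trans; apply: leq_trans n26.
  by apply: leq_ltn_trans Nn _; rewrite ltn_mul2r p25.
have r5 : (5 <= r)%N.
  have : (2 ^ 5 <= 2 ^ r)%N.
    apply: leq_trans nN; apply: (@leq_trans (2 ^ 25)); first by rewrite leq_exp2l.
    by apply: leq_expl; lia.
  by rewrite leq_exp2l.
have [T [sT fT]] := first_exists r5.
have hT : ~ easy T by move=> eT; apply: fT; left.
pose xt (j : 'I_N) := padded n (bits (N + j)).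
pose f (x : n.-tuple bool) := g x.
have fE (j : 'I_N) : f (xt j) = nth false T j.
  have Lj : L (xt j) <-> nth false T j.
    apply: (Lfirst _ r) => //; last by rewrite size_tuple -/N;
      apply: leq_trans (leq_expl 26 (leqnSn n)); apply: leq_trans Nn (leq_trans _ n26);
      rewrite leq_mul2r orbT.
    rewrite -[RHS]bval_bits; apply: bval_nth => q; rewrite nth_padded // size_bits_le //.
    apply: (@leq_trans (2 ^ r.+1)); last by rewrite leq_exp2l.
    by rewrite expnS; have := ltn_ord j; rewrite /N; lia.
  by apply/asboolP/idP => /Lj.
have N0 : (0 < N)%N by rewrite expn_gt0.
pose P := unif R xt.
have dP : is_dist P by exact: unif_dist.
have hf : computes (phi := str_interp (U k.+1)) h f.
  by move=> x; apply: Uh; rewrite size_tuple.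
have [b [eb b0 bm]] : exists b, [/\ sample_cplx (str_interp (U k.+1)) f P (1 / 4) (1 / 2) = Some b,
    (0 < b)%N & (b <= m0)%N].
  apply: sample_cplx_le => //; apply: (mdl_pac_occam dP _ hf); first by lra.
  exact: occam_numeric.
have := gainK n nn2.
apply/negP; rewrite -ltNge.
have up : (Defs.ratio R (sample_cplx Cinterp f P (1 / 4) (1 / 2))
    (sample_cplx (str_interp (U k.+1)) f P (1 / 4) (1 / 2))
   <= gain (str_interp (U k.+1)) Cinterp 1 (1 / 4) (1 / 2) n)%E.
  apply: ereal_sup_ubound; exists f, P; split=> //; split=> //.
  by exists h; split=> //=; rewrite expn1.
apply: lt_le_trans up; rewrite eb.
have := @sample_cplx_gt R Cinterp n f P (1 / 4) (1 / 2) (n ^ 3)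
  (2 * n + 2 + (4 + n ^ 3 * (5 + 3 * n)) * (3 + 2 * (4 + n ^ 3 * (5 + 3 * n)) + n)).
(* If circuits never reach the required performance, the ratio is infinite and exceeds the bound at
   once. *)
case: sample_cplx => [a|_] /=; last by rewrite ltry.
move=> /(_ _ _ _ a erefl) an; rewrite lte_fin.
have {}an : (n ^ 3 < a)%N.
  apply: an; first by lra.
    by move=> xs; apply: memorizing_circuit; lia.
  move=> C tot lenC.
  exact: (circuit_error R sT hT rn (leq_trans (memory_bound n10) nN) fE tot lenC).
have -> : (1 + 1 = 2%:R :> R) by [].
rewrite powR_mulrn ?ler0n // ltr_pdivlMr ?ltr0n //.
have nr : 0 < n%:R :> R by rewrite ltr0n; lia.
have bm' : b%:R <= m0%:R :> R by rewrite ler_nat.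
have an' : n%:R ^+ 3 < a%:R :> R by rewrite -natrX ltr_nat.
have nK : m0%:R * K < n%:R by apply: lt_le_trans n4K _; rewrite ler_nat.
have bK : b%:R * K < n%:R.
  (* K may be negative, and [b <= m0] can be multiplied by K only when it is not. *)
  have [K0|K0] := leP 0 K; first by apply: le_lt_trans nK; exact: ler_wpM2r.
  by apply: le_lt_trans nr; apply: mulr_ge0_le0 => //; exact: ltW.
apply: lt_trans an'; rewrite [_ ^+ 3]exprS mulrAC [K * _]mulrC ltr_pM2r //.
by rewrite exprn_gt0.
Qed.
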